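(* Let $X$ be a ball Banach function space on $\mathbb R^n$ such that the Hardy--Littlewood maximal operator $\mathcal M$ is bounded on $X$, and let $b\in L^1_{\rm loc}(\mathbb R^n)$. Let $\Omega\in L^\infty(\mathbb S^{n-1})$ be homogeneous of degree zero with $\int_{\mathbb S^{n-1}}\Omega\,d\sigma=0$, and suppose there exists an open set $\Lambda\subset\mathbb S^{n-1}$ such that $\Omega$ does not change sign on $\Lambda$. If $[b,T_\Omega]$ is bounded on $X$, then $b\in{\rm BMO}(\mathbb R^n)$ and there exists a positive constant $C$, independent of $b$, such that $$\|b\|_{{\rm BMO}(\mathbb R^n)}\le C\|[b,T_\Omega]\|_{X\to X}.$$
   Context: Ball Banach function space: let $\mathscr M(\mathbb R^n)$ be the set of all measurable functions on $\mathbb R^n$. A Banach space $X\subset\mathscr M(\mathbb R^n)$ (with $\|f\|_X=\infty$ for $f\notin X$) is a ball Banach function space if: $\|f\|_X=0$ implies $f=0$ a.e.; $|g|\le|f|$ a.e. implies $\|g\|_X\le\|f\|_X$; $0\le f_m\uparrow f$ a.e. implies $\|f_m\|_X\uparrow\|f\|_X$; $\mathbf 1_B\in X$ for every ball $B$; $\|f+g\|_X\le\|f\|_X+\|g\|_X$; and for every ball $B$ there is $C_{(B)}>0$ with $\int_B|f|\,dx\le C_{(B)}\|f\|_X$ for all $f\in X$. $\mathcal M(f)(x):=\sup_{B\ni x}\frac1{|B|}\int_B|f(y)|\,dy$, the supremum being over all balls $B$ containing $x$. $\mathbb S^{n-1}$ is the unit sphere with area measure $d\sigma$. Homogeneous of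 degree zero: $\Omega(\mu x)=\Omega(x)$ for $\mu\in(0,\infty)$, $x\in\mathbb S^{n-1}$, so $\Omega$ is defined on $\mathbb R^n\setminus\{0\}$. $T_\Omega(f)(x):=\lim_{\varepsilon\to0^+}\int_{\varepsilon<|x-y|<1/\varepsilon}\frac{\Omega(x-y)}{|x-y|^n}f(y)\,dy$. The commutator is $[b,T_\Omega](f)(x):=b(x)T_\Omega(f)(x)-T_\Omega(bf)(x)$, for bounded $f$ with compact support, and by the same formula for $f\in X$; for a bounded measurable set $F$ and $x\notin\overline F$, $[b,T_\Omega](\mathbf 1_F)(x)=\int_F[b(x)-b(y)]\frac{\Omega(x-y)}{|x-y|^n}\,dy$. Bounded on $X$ means that it maps $X$ into $X$ with finite operator norm $\|[b,T_\Omega]\|_{X\to X}$. ${\rm BMO}(\mathbb R^n)$: locally integrable $f$ with $\|f\|_{{\rm BMO}(\mathbb R^n)}:=\sup_B\frac1{|B|}\int_B|f-f_B|\,dx<\infty$, sup over all balls, $f_B:=\frac1{|B|}\int_Bf$.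
   Formalization: ''Ω does not change sign on Λ'' is read as: Ω ≥ 0 a.e. or Ω ≤ 0 a.e. on Λ, and Ω is not a.e. zero on Λ; without the last condition Ω = 0 (or Λ empty) makes [b,T_Ω] = 0 bounded for every b, so the claim fails. *)

(* Defs.v *)
From HB Require Import structures.
From mathcomp Require Import all_boot all_order all_algebra.
From mathcomp Require Import all_classical all_reals all_analysis.
From mathcomp Require Import measurable_realfun lra.

Set Implicit Arguments.
Unset Strict Implicit.
Unset Printing Implicit Defensive.

Import Order.TTheory GRing.Theory Num.Def Num.Theory.
Import numFieldNormedType.Exports.

Local Open Scope classical_set_scope.
Local Open Scope ring_scope.

(* The Euclidean space of dimension n.+1 (so every dimension >= 1 occurs).
   The norm `| x | and the topology inherited from 'rV are those of the sup
   norm; balls and spheres below are Euclidean. *)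
Definition Rn (R : realType) (n : nat) := 'rV[R]_n.+1.
HB.instance Definition _ (R : realType) (n : nat) :=
  NormedModule.copy (Rn R n) 'rV[R]_n.+1.

Section euclidean.
Context {R : realType} {n : nat}.
Implicit Types (x y a b : Rn R n) (r : R).

Definition enorm x : R := Num.sqrt (\sum_(i < n.+1) x ord0 i ^+ 2).

Definition eball x r : set (Rn R n) := [set y | enorm (y - x) < r].

Definition sphere : set (Rn R n) := [set x | enorm x = 1].

Definition direction x : Rn R n := (enorm x)^-1 *: x.

Definition box a b : set (Rn R n) :=
  [set x | forall i, a ord0 i < x ord0 i <= b ord0 i].

Definition box_volume a b : R :=
  \prod_(i < n.+1) Num.max 0 (b ord0 i - a ord0 i).

Definition box_cover (A : set (Rn R n)) : set (nat -> Rn R n * Rn R n) :=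
  [set F | A `<=` \bigcup_k box (F k).1 (F k).2].

Definition lebesgue_outer (A : set (Rn R n)) : \bar R :=
  ereal_inf [set (\sum_(k <oo) (box_volume (F k).1 (F k).2)%:E)%E
            | F in box_cover A].

End euclidean.

Section lebesgue_outer_measure.
Context {R : realType} {n : nat}.
Local Notation mu := (@lebesgue_outer R n).
Implicit Types (a b : Rn R n) (A : set (Rn R n)).
Local Open Scope ereal_scope.

Lemma box_volume_ge0 a b : (0 <= box_volume a b)%R.
Proof. by apply: prodr_ge0 => i _; rewrite le_max lexx. Qed.

Lemma lebesgue_outer_ge0 A : 0 <= mu A.
Proof.
apply: le_ereal_inf_tmp => x [F AF <-{x}].
by apply: nneseries_ge0 => k _ _; rewrite lee_fin box_volume_ge0.
Qed.

Lemma le_lebesgue_outer : {homo mu : A B / A `<=` B >-> A <= B}.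
Proof.
move=> A B AB; apply/ereal_inf_le_tmp => x [F BF <-{x}].
by exists F => //; apply: subset_trans AB BF.
Qed.

Lemma lebesgue_outer0 : mu set0 = 0.
Proof.
apply/eqP; rewrite eq_le; apply/andP; split; last exact/lebesgue_outer_ge0.
apply: ereal_inf_lbound; exists (fun=> (0%R, 0%R)); first by move=> x.
rewrite eseries0// => k _ _ /=.
by rewrite /box_volume big_ord_recl subrr maxxx mul0r.
Qed.

(* adapted from mu_ext_sigma_subadditive *)
Lemma lebesgue_outer_sigma_subadditive : sigma_subadditive mu.
Proof.
move=> A; have [[i ioo]|] := pselect (exists i, mu (A i) = +oo).
  rewrite (eseries_pinfty _ _ ioo) ?leey// => k _.
  by rewrite -ltNye (lt_le_trans _ (lebesgue_outer_ge0 _)).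
rewrite -forallNE => Aoo.
suff add2e (e : {posnum R}) :
    mu (\bigcup_n A n) <= \sum_(i <oo) mu (A i) + e%:num%:E.
  by apply/lee_addgt0Pr => _/posnumP[].
rewrite (le_trans _ (epsilon_trick _ _ _))//; last first.
  by move=> k; exact: lebesgue_outer_ge0.
pose v (F : Rn R n * Rn R n) : \bar R := (box_volume F.1 F.2)%:E.
have v0 F : 0 <= v F by rewrite lee_fin box_volume_ge0.
pose P k (B : nat -> Rn R n * Rn R n) := box_cover (A k) B /\
  \sum_(j <oo) v (B j) <= mu (A k) + (e%:num / (2 ^ k.+1)%:R)%:E.
have [G PG] : {G : nat -> nat -> Rn R n * Rn R n & forall k, P k (G k)}.
  apply: (@choice _ _ P) => k; rewrite /P /lebesgue_outer.
  set S := (X in ereal_inf X); move infS : (ereal_inf S) => iS.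
  case: iS infS => [r Sr|Soo|Soo].
  - have en1 : (0 < e%:num / (2 ^ k.+1)%:R)%R by [].
    have /(lb_ereal_inf_adherent en1) : ereal_inf S \is a fin_num by rewrite Sr.
    move=> [x [B AnB muBx] xS].
    by exists B; split => //; rewrite muBx -Sr; exact/ltW.
  - by have := Aoo k; rewrite /lebesgue_outer Soo.
  - suff : lbound S 0 by move/le_ereal_inf_tmp; rewrite Soo.
    by move=> /= _ [B AnB <-]; apply: nneseries_ge0 => j _ _; exact: v0.
have vG_ge0 x : 0 <= (v \o uncurry G) x by exact: v0.
apply: (@le_trans _ _ (\esum_(i in setT) (v \o uncurry G) i)).
  apply: ereal_inf_lbound => /=.
  have /card_esym/ppcard_eqP[f] := card_nat2.
  exists (uncurry G \o f).
    move=> t [i _ /((PG i).1)[j _ Bijt]]; exists (f^-1%FUN (i, j)) => //=.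
    by rewrite invK ?inE.
  rewrite -(esum_pred_image (v \o uncurry G) _ xpredT) ?[fun=> _]set_true//.
  by rewrite image_eq.
rewrite (_ : esum _ _ = \sum_(i <oo) \sum_(j <oo ) v (G i j)); last first.
  pose J : nat -> set (nat * nat) := fun i => [set (i, j) | j in setT].
  rewrite (_ : setT = \bigcup_k J k); last first.
    by rewrite predeqE => -[a b]; split => // _; exists a => //; exists b.
  rewrite esum_bigcupT /=; last 2 first.
    - apply/trivIsetP => i j _ _ ij.
      rewrite predeqE => -[k m] /=; split => //= -[] [_] _ [<-{k} _].
      by move=> [m' _] [] /esym/eqP; rewrite (negbTE ij).
    - by move=> x; exact: (vG_ge0 x).
  rewrite -(image_id [set: nat]) -fun_true esum_pred_image//; last first.
    by move=> k _; apply: esum_ge0 => x _; exact: (vG_ge0 x).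
  apply: eq_eseriesr => /= j _.
  rewrite -(esum_pred_image (v \o uncurry G) (pair j) predT)//=; last first.
    by move=> ? ? _ _; exact: (@can_inj _ _ _ snd).
  by congr esum; rewrite predeqE => -[a b]; split; move=> [i _ <-]; exists i.
apply: lee_lim.
- apply: is_cvg_nneseries => k *.
  by apply: nneseries_ge0 => m *; exact: (vG_ge0 (k, m)).
- apply: is_cvg_nneseries => k *; apply: adde_ge0 => //.
  exact: lebesgue_outer_ge0.
- by near=> k; apply: lee_sum => i _; exact: (PG i).2.
Unshelve. all: by end_near. Qed.

HB.instance Definition _ := isOuterMeasure.Build R (Rn R n) lebesgue_outer
  lebesgue_outer0 lebesgue_outer_ge0 le_lebesgue_outer
  lebesgue_outer_sigma_subadditive.

End lebesgue_outer_measure.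

(* Measurability on Rn is Lebesgue (not only Borel) measurability. *)
HB.instance Definition _ (R : realType) (n : nat) :=
  @isMeasurable.Build (caratheodory_display (@lebesgue_outer R n)) (Rn R n)
    (@lebesgue_outer R n).-caratheodory
    (caratheodory_measurable_set0 (@lebesgue_outer R n))
    (@caratheodory_measurable_setC _ _ (@lebesgue_outer R n))
    (@caratheodory_measurable_bigcup _ _ (@lebesgue_outer R n)).

Definition leb {R : realType} {n : nat} : set (Rn R n) -> \bar R :=
  lebesgue_outer.

HB.instance Definition _ (R : realType) (n : nat) :=
  isMeasure.Build _ (Rn R n) R (@leb R n)
    (caratheodory_measure0 (@lebesgue_outer R n))
    (@caratheodory_measure_ge0 _ _ (@lebesgue_outer R n))
    (@caratheodory_measure_sigma_additive _ _ (@lebesgue_outer R n)).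

Section coordinates_measurable.
Context {R : realType} {n : nat}.
Implicit Types (a b x : Rn R n) (c : R) (i : 'I_n.+1).

Definition set_coord i c x : Rn R n :=
  \row_j (if j == i then c else x ord0 j).

Lemma box_volume_split i c a b :
  box_volume a (set_coord i (Num.min c (b ord0 i)) b) +
  box_volume (set_coord i (Num.max c (a ord0 i)) a) b = box_volume a b.
Proof.
rewrite /box_volume (bigD1 i)//= [X in _ + X](bigD1 i)//= [RHS](bigD1 i)//=.
rewrite !mxE eqxx.
under eq_bigr => j ji do rewrite mxE (negbTE ji).
under [X in _ + _ * X]eq_bigr => j ji do rewrite mxE (negbTE ji).
rewrite -mulrDl; congr (_ * _).
move: (a ord0 i) (b ord0 i) => u v.
case: (leP c v) => cv; case: (leP c u) => cu;
  by rewrite /Num.max; repeat case: ltP => ? //; lra.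
Qed.

Lemma measurable_halfspace i c :
  measurable ([set x | x ord0 i <= c] : set (Rn R n)).
Proof.
apply: (@le_caratheodory_measurable _ _ (@lebesgue_outer R n)) => X.
apply: le_ereal_inf_tmp => _ [F XF <-].
pose F1 k := ((F k).1, set_coord i (Num.min c ((F k).2 ord0 i)) (F k).2).
pose F2 k := (set_coord i (Num.max c ((F k).1 ord0 i)) (F k).1, (F k).2).
have c1 : box_cover (X `&` [set x | x ord0 i <= c]) F1.
  move=> x [/XF[k _ xk] xc]; exists k => // j /=; rewrite mxE.
  by case: eqP => [->|_]; [rewrite le_min xc; case/andP: (xk i) => -> ->|].
have c2 : box_cover (X `&` ~` [set x | x ord0 i <= c]) F2.
  move=> x [/XF[k _ xk] /negP xc]; exists k => // j /=; rewrite mxE.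
  case: eqP => [->|_]; last exact: xk.
  by rewrite gt_max ltNge xc; case/andP: (xk i) => -> ->.
pose vol (G : nat -> Rn R n * Rn R n) : \bar R :=
  (\sum_(k <oo) (box_volume (G k).1 (G k).2)%:E)%E.
apply: (@le_trans _ _ (vol F1 + vol F2)%E).
  by apply: leeD; apply: ereal_inf_lbound; [exists F1|exists F2].
rewrite /vol -nneseriesD; try by move=> *; rewrite lee_fin box_volume_ge0.
rewrite le_eqVlt; apply/orP; left; apply/eqP.
by apply: eq_eseriesr => k _; rewrite -EFinD box_volume_split.
Qed.

Lemma measurable_coord i :
  measurable_fun setT (fun x : Rn R n => x ord0 i : R).
Proof.
apply: (measurability _ (measurable_realfun.RGenOInfty.measurableE R)) => //.
move=> _ [_ [c ->] <-]; rewrite setTI.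
rewrite (_ : _ @^-1` _ = ~` [set x : Rn R n | x ord0 i <= c]).
  exact/measurableC/measurable_halfspace.
apply/seteqP; split => x /=; rewrite in_itv/= andbT.
  by rewrite ltNge => /negP.
by move/negP; rewrite -ltNge.
Qed.

Lemma measurable_enorm : measurable_fun setT (@enorm R n).
Proof.
apply: (@measurableT_comp _ _ _ _ _ _ (@Num.sqrt R)).
  by apply: continuous_measurable_fun; exact: sqrt_continuous.
apply: measurable_sum => i; apply: measurable_funX.
exact: measurable_coord.
Qed.

Lemma measurable_punctured_ball :
  measurable ([set x | 0 < enorm x < 1] : set (Rn R n)).
Proof.
have := measurable_enorm measurableT (measurable_itv `]0, 1[).
by rewrite setTI /preimage/=; under eq_set do rewrite in_itv/=.
Qed.

End coordinates_measurable.

(* Copy of Rn carrying the sigma-algebra of the area measure: A is measurable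
   iff the cone over A is Lebesgue measurable. *)
Definition direction_space (R : realType) (n : nat) := Rn R n.
HB.instance Definition _ (R : realType) (n : nat) :=
  NormedModule.copy (direction_space R n) 'rV[R]_n.+1.

Section sphere_measure.
Context {R : realType} {n : nat}.
Local Notation S := (direction_space R n).

Definition cone_measurable : set (set S) :=
  [set A | measurable (@direction R n @^-1` A)].

Lemma cone_measurable0 : cone_measurable set0.
Proof. by rewrite /cone_measurable/= preimage_set0; exact: measurable0. Qed.

Lemma cone_measurableC A : cone_measurable A -> cone_measurable (~` A).
Proof.
by rewrite /cone_measurable/= preimage_setC => ?; exact: measurableC.
Qed.

Lemma cone_measurable_bigcup (F : (set S)^nat) :
  (forall i, cone_measurable (F i)) -> cone_measurable (\bigcup_i F i).
Proof.
move=> mF; rewrite /cone_measurable/= preimage_bigcup.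
by apply: bigcupT_measurable => i; exact: mF.
Qed.

Fact cone_display : measure_display. Proof. by []. Qed.

HB.instance Definition _ := @isMeasurable.Build cone_display S
  cone_measurable cone_measurable0 cone_measurableC cone_measurable_bigcup.

(* Area measure of the unit sphere: n.+1 (the dimension) times the volume of
   the truncated cone over A; in dimension one it is the counting measure on
   {-1, 1}. *)
Definition sphere_measure (A : set S) : \bar R :=
  (n.+1%:R%:E * leb (direction @^-1` A `&` [set x | (0 < enorm x < 1)%R]))%E.

Lemma sphere_measure0 : sphere_measure set0 = 0%E.
Proof. by rewrite /sphere_measure preimage_set0 set0I measure0 mule0. Qed.

Lemma sphere_measure_ge0 A : (0 <= sphere_measure A)%E.
Proof. by rewrite /sphere_measure mule_ge0 ?lee_fin. Qed.

Lemma sphere_measure_sigma_additive : semi_sigma_additive sphere_measure.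
Proof.
move=> F mF tF mUF.
pose s := mscale (NngNum (ler0n R n.+1)) (mrestr leb (@measurable_punctured_ball R n)).
have -> : sphere_measure = (fun A => s (direction @^-1` A)) by [].
rewrite preimage_bigcup; apply: (@measure_semi_sigma_additive _ _ _ s).
- exact: mF.
- apply/trivIsetP => i j _ _ ij; rewrite -preimage_setI.
  by move/trivIsetP : tF => /(_ _ _ I I ij) ->; rewrite preimage_set0.
- by apply: bigcupT_measurable => i; exact: mF.
Qed.

HB.instance Definition _ := isMeasure.Build _ S R sphere_measure
  sphere_measure0 sphere_measure_ge0 sphere_measure_sigma_additive.

End sphere_measure.

Section function_spaces.
Context {R : realType} {n : nat}.
Implicit Types (f g b : Rn R n -> R) (B Lambda : set (Rn R n)).
Implicit Types (N : (Rn R n -> R) -> \bar R) (Omega : Rn R n -> R).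

(* The space X is represented by its norm N, with value +oo off X; hence
   f \in X is N f < +oo. *)
Record ball_banach_function_space N : Prop := {
  bbfs_measurable : forall f, (N f < +oo)%E -> measurable_fun setT f ;
  bbfs_ge0 : forall f, (0 <= N f)%E ;
  bbfs_eq0 : forall f, N f = 0%E -> {ae leb, forall x, f x = 0} ;
  bbfsZ : forall (c : R) f, (N f < +oo)%E ->
    N (fun x => c * f x) = (`|c|%:E * N f)%E ;
  bbfs_triangle : forall f g, measurable_fun setT f -> measurable_fun setT g ->
    (N (fun x => f x + g x)%R <= N f + N g)%E ;
  bbfs_complete : forall u : nat -> Rn R n -> R,
    (forall k, N (u k) < +oo)%E ->
    (forall e : R, 0 < e -> exists K, forall k l, (K <= k)%N -> (K <= l)%N ->
      (N (fun x => u k x - u l x)%R <= e%:E)%E) ->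
    exists2 f, (N f < +oo)%E & N (fun x => u k x - f x) @[k --> \oo] --> 0%E ;
  bbfs_lattice : forall f g, measurable_fun setT f -> measurable_fun setT g ->
    {ae leb, forall x, `|g x| <= `|f x|} -> (N g <= N f)%E ;
  bbfs_fatou : forall (u : nat -> Rn R n -> R) f,
    (forall k, measurable_fun setT (u k)) -> measurable_fun setT f ->
    {ae leb, forall x, (forall k, 0 <= u k x <= u k.+1 x) /\
                       u k x @[k --> \oo] --> f x} ->
    nondecreasing_seq (fun k => N (u k)) /\ N (u k) @[k --> \oo] --> N f ;
  bbfs_ball : forall x r, 0 < r -> (N (\1_(eball x r)) < +oo)%E ;
  bbfs_integral : forall x r, 0 < r -> exists2 C : R, 0 < C &
    forall f, (N f < +oo)%E ->
      (\int[leb]_(y in eball x r) `|f y|%:E <= C%:E * N f)%E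
}.

Definition average B f : \bar R :=
  (((fine (leb B))^-1)%:E * \int[leb]_(y in B) `|f y|%:E)%E.

Definition maximal f (x : Rn R n) : \bar R :=
  ereal_sup [set average (eball p.1 p.2) f
            | p in [set p : Rn R n * R | 0 < p.2 /\ eball p.1 p.2 x]].

(* `maximal f` is extended-valued while X consists of real functions; M f \in X
   entails that it is finite almost everywhere. *)
Definition maximal_bounded N : Prop :=
  exists C : R, forall f, (N f < +oo)%E ->
    {ae leb, forall x, maximal f x \is a fin_num} /\
    (N (fun x => fine (maximal f x)) <= C%:E * N f)%E.

Definition locally_integrable_Rn f : Prop :=
  measurable_fun setT f /\
  forall K, compact K -> (\int[leb]_(x in K) `|f x|%:E < +oo)%E.

Definition mean B f : R := (fine (leb B))^-1 * \int[leb]_(y in B) f y.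

Definition bmo_norm f : \bar R :=
  ereal_sup [set average (eball p.1 p.2) (fun y => f y - mean (eball p.1 p.2) f)
            | p in [set p : Rn R n * R | 0 < p.2]].

Definition bmo f : Prop := locally_integrable_Rn f /\ (bmo_norm f < +oo)%E.

Definition homogeneous_degree0 Omega : Prop :=
  forall (mu : R) (x : Rn R n), 0 < mu -> sphere x ->
    Omega (mu *: x) = Omega x.

Definition Linfty_sphere (Omega : direction_space R n -> R) : Prop :=
  measurable_fun (sphere : set (direction_space R n)) Omega /\
  ('N[sphere_measure]_+oo [EFin \o Omega] < +oo)%E.

Definition open_in_sphere Lambda : Prop :=
  exists2 U : set (Rn R n), open U & Lambda = U `&` sphere.

(* Omega has one sign, almost everywhere on Lambda, and this sign is a genuine
   one: without the last clause Omega = 0 or Lambda = set0 would qualify, and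
   the commutator with Omega = 0 is bounded for every b. *)
Definition keeps_sign (Omega : direction_space R n -> R) Lambda : Prop :=
  ({ae sphere_measure, forall x, Lambda x -> 0 <= Omega x} \/
   {ae sphere_measure, forall x, Lambda x -> Omega x <= 0}) /\
  ~ {ae sphere_measure, forall x, Lambda x -> Omega x = 0}.

Definition annulus (x : Rn R n) (e : R) : set (Rn R n) :=
  [set y | e < enorm (x - y) < e^-1].

Definition integrand Omega f (x y : Rn R n) : R :=
  Omega (x - y) / enorm (x - y) ^+ n.+1 * f y.

Definition truncated Omega f (x : Rn R n) (e : R) : R :=
  \int[leb]_(y in annulus x e) integrand Omega f x y.

Definition singular_integral Omega f (x : Rn R n) : R :=
  lim (truncated Omega f x e @[e --> 0^'+]).

(* `lim` and the integral are total; this says that singular_integral is the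
   genuine limit of genuine integrals. *)
Definition singular_integral_exists Omega f (x : Rn R n) : Prop :=
  (forall e : R, 0 < e ->
    leb.-integrable (annulus x e) (EFin \o integrand Omega f x)) /\
  cvg (truncated Omega f x e @[e --> 0^'+]).

Definition commutator b Omega f (x : Rn R n) : R :=
  b x * singular_integral Omega f x -
  singular_integral Omega (fun y => b y * f y) x.

Definition commutator_exists b Omega f : Prop :=
  {ae leb, forall x, singular_integral_exists Omega f x /\
                     singular_integral_exists Omega (fun y => b y * f y) x}.

Definition commutator_opnorm N b Omega : \bar R :=
  ereal_sup [set N (commutator b Omega f) | f in [set f | (N f <= 1)%E]].

Definition commutator_bounded N b Omega : Prop :=
  (forall f, (N f < +oo)%E ->
    commutator_exists b Omega f /\ (N (commutator b Omega f) < +oo)%E) /\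
  (commutator_opnorm N b Omega < +oo)%E.

End function_spaces.

(* Main.v *)
Require Import Defs.
From mathcomp Require Import all_boot all_order all_algebra.
From mathcomp Require Import all_classical all_reals all_analysis.
From mathcomp Require Import measurable_realfun lra ring.

(* Let [Om] be [Omega] or [-Omega], nonnegative over [Lambda].  A covering
   argument gives a box Q in the cone over Lambda, away from the origin, of
   which [Om >= e] fills all but a small proportion.  For a ball B of radius r,
   reflecting and dilating the middle half of Q yields a box A, of size and
   distance to B comparable with r, such that x - A lies in a dilate of Q for
   every x in B; hence [Om (x - y) >= e] for most y in A, and [Om (x - y) >= 0]
   for almost all.  If m is a median of b on A and F1, F2 are the parts of A
   where b <= m and b >= m, then b(x) - b(y) has a constant sign on F1 or on
   F2, so |b(x) - m| is bounded on B by the commutators g of 1_F1 and 1_F2.  On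
   A the maximal function of g is at least a multiple of the average of |g| over
   B, so that average times ||1_A|| is at most a multiple of ||g||, hence of
   ||[b, T]|| ||1_A||, and ||1_A|| cancels. *)

Import Order.TTheory GRing.Theory Num.Def Num.Theory.
Import numFieldNormedType.Exports.

Local Open Scope classical_set_scope.
Local Open Scope ring_scope.

(** * Measure-theoretic preliminaries *)

Lemma measurable_superlevel d (T : measurableType d) (R : realType)
    (D : set T) (g : T -> R) (q : R) :
  measurable D -> measurable_fun D g -> measurable (D `&` [set x | q <= g x]).
Proof.
move=> mD mg; rewrite (_ : [set x | _] = g @^-1` `[q, +oo[%classic).
  exact: mg.
by apply/seteqP; split => x /=; rewrite in_itv/= andbT.
Qed.

Lemma measurable_sublevel d (T : measurableType d) (R : realType)
    (D : set T) (g : T -> R) (q : R) :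
  measurable D -> measurable_fun D g -> measurable (D `&` [set x | g x <= q]).
Proof.
move=> mD mg; rewrite (_ : [set x | _] = g @^-1` `]-oo, q]%classic).
  exact: mg.
by apply/seteqP; split => x /=; rewrite in_itv.
Qed.

Lemma measurable_fun_normr_EFin d (T : measurableType d) (R : realType)
    (D : set T) (g : T -> R) :
  measurable_fun setT g -> measurable_fun D (fun x => `|g x|%:E).
Proof.
move=> mg; apply/measurable_EFinP; apply: measurableT_comp => //.
exact: measurable_funTS.
Qed.

(** Serves to integrate the bound on the oscillation of [b] by two commutators whose integrals have
    a common bound [c]; hence the factor 2. *)
Lemma ae_le_normr_integral d (T : measurableType d) (R : realType)
    (mu : {measure set T -> \bar R}) (D : set T) (f g h : T -> R) (k c : R) :
  measurable D -> measurable_fun setT f -> measurable_fun setT g ->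
  measurable_fun setT h -> 0 <= k ->
  {ae mu, forall x, D x -> `|f x| <= k * (`|g x| + `|h x|)} ->
  (\int[mu]_(x in D) `|g x|%:E <= c%:E)%E ->
  (\int[mu]_(x in D) `|h x|%:E <= c%:E)%E ->
  (\int[mu]_(x in D) `|f x|%:E <= (k * (2 * c))%:E)%E.
Proof.
move=> mD mf mg mh k0 fgh gc hc.
have mng := measurable_fun_normr_EFin _ _ _ D _ mg.
have mnh := measurable_fun_normr_EFin _ _ _ D _ mh.
have mnf := measurable_fun_normr_EFin _ _ _ D _ mf.
have mgh : measurable_fun D (fun x => `|g x|%:E + `|h x|%:E)%E.
  exact: emeasurable_funD.
have gh0 x : D x -> (0 <= `|g x|%:E + `|h x|%:E)%E.
  by move=> _; rewrite -EFinD lee_fin.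
apply: (@le_trans _ _ (\int[mu]_(x in D) (k%:E * (`|g x|%:E + `|h x|%:E)))%E).
  apply: ae_ge0_le_integral => //.
  - by move=> x _; rewrite -EFinD -EFinM lee_fin mulr_ge0.
  - exact: emeasurable_funM.
rewrite ge0_integralZl_EFin// ge0_integralD// EFinM.
apply: lee_wpmul2l; first by rewrite lee_fin.
by rewrite mulr2n mulrDl mul1r EFinD; exact: leeD.
Qed.

(** As [g] is nonnegative only almost everywhere, the argument runs with the absolute value of [g],
    which has the same integral and dominates [q] on the superlevel set. *)
Lemma markov_Rintegral d (T : measurableType d) (R : realType)
    (mu : {measure set T -> \bar R}) (D : set T) (g : T -> R) (q : R) :
  measurable D -> mu.-integrable D (EFin \o g) ->
  {ae mu, forall x, D x -> 0 <= g x} -> 0 <= q ->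
  (q%:E * mu (D `&` [set x | (q <= g x)%R]) <= (\int[mu]_(x in D) g x)%:E)%E.
Proof.
move=> mD ig g0 q0; have mg := measurable_int _ ig.
have mW := measurable_superlevel _ _ _ _ _ q mD (iffLR (measurable_EFinP _ _) mg).
have mng : measurable_fun D (fun x => `|g x|%:E).
  exact: (measurableT_comp (@abse_measurable _ setT) mg).
rewrite /Rintegral fineK; last exact: integrable_fin_num.
rewrite (ae_eq_integral (fun x => `|g x|%:E))//; last first.
  by apply: filterS g0 => x h Dx /=; rewrite ger0_norm// h.
set W := D `&` _ in mW *.
have WD : W `<=` D by move=> x [].
apply: (@le_trans _ _ (\int[mu]_(x in W) `|g x|%:E)%E); last first.
  by apply: (ge0_subset_integral mu mW mD mng) => // x Dx; rewrite lee_fin.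
rewrite -(integral_cst mu mW q%:E).
apply: ge0_le_integral => //.
- exact: measurable_funS mng.
- by move=> x [_ /=] qx; rewrite lee_fin (le_trans qx)// ler_norm.
Qed.

(** The distance from [m] to the mean is at most the average of [|f - m|], so passing from [m] to
    the mean at most doubles the integral. *)
Lemma mean_oscillation_le d (T : measurableType d) (R : realType)
    (mu : {measure set T -> \bar R}) (D : set T) (f : T -> R) (m : R) :
  measurable D -> (0 < mu D)%E -> (mu D < +oo)%E -> mu.-integrable D (EFin \o f) ->
  (\int[mu]_(x in D) `|f x - (fine (mu D))^-1 * \int[mu]_(y in D) f y|%:E <=
   2%:E * \int[mu]_(x in D) `|f x - m|%:E)%E.
Proof.
move=> mD D0 Doo fi.
have Dfin : mu D \is a fin_num by rewrite ge0_fin_numE// ltW.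
have c0 : 0 < fine (mu D) by rewrite fine_gt0// D0 Doo.
set c := fine (mu D) in c0 *.
have icst (r : R) : mu.-integrable D (EFin \o (fun=> r)).
  apply/integrableP; split; first exact: measurable_cst.
  rewrite [ltLHS](integral_cst mu mD `|r|%:E) -(fineK Dfin) -EFinM; exact: ltry.
have iB (r : R) : mu.-integrable D (EFin \o (fun x => f x - r)).
  exact: (integrableB mD fi (icst r)).
have iN (g : T -> R) : mu.-integrable D (EFin \o g) ->
    mu.-integrable D (EFin \o (fun x => `|g x|)).
  by move/integrable_norm.
have iE r : (\int[mu]_(x in D) `|f x - r|%:E = (\int[mu]_(x in D) `|f x - r|)%:E)%E.
  by rewrite /Rintegral fineK//; apply: integrable_fin_num => //; exact: iN.
rewrite !iE -EFinM lee_fin.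
set M := c^-1 * _.
have mM : `|m - M| <= c^-1 * \int[mu]_(x in D) `|f x - m|.
  have -> : m - M = - (c^-1 * \int[mu]_(x in D) (f x - m)).
    rewrite RintegralB// Rintegral_cst// -/c mulrBr -/M mulrC mulrK ?opprB//.
    by rewrite unitfE gt_eqF.
  rewrite normrN normrM (ger0_norm (_ : 0 <= c^-1)) ?invr_ge0 ?(ltW c0)//.
  apply: ler_wpM2l; first by rewrite invr_ge0 ltW.
  exact: le_normr_Rintegral.
have -> : 2 * \int[mu]_(x in D) `|f x - m| = \int[mu]_(x in D) `|f x - m| +
    (c^-1 * \int[mu]_(x in D) `|f x - m|) * c.
  by rewrite mulrAC mulVf ?gt_eqF// mul1r mulr2n mulrDl mul1r.
apply: le_trans (_ : \int[mu]_(x in D) `|f x - m| + `|m - M| * c <= _); last first.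
  by rewrite lerD2l ler_wpM2r// ltW.
rewrite -(Rintegral_cst _ mD) -RintegralD//; last exact: iN.
apply: le_Rintegral => //; [exact: iN| |].
  exact: (integrableD mD (iN _ (iB m)) (icst _)).
by move=> x _; rewrite (le_trans _ (ler_normD _ _))// addrA subrK.
Qed.

(** * Existence of medians *)

Section median.
Context d (T : measurableType d) (R : realType) (mu : {measure set T -> \bar R}).
Implicit Types (F : set T) (E : (set T)^nat) (b : T -> R) (v : \bar R).

Lemma measure_bigcup_le E v : (forall k, measurable (E k)) ->
  nondecreasing_seq E -> (forall k, mu (E k) <= v)%E ->
  (mu (\bigcup_k E k) <= v)%E.
Proof.
move=> mE ndE Ev.
have cE := nondecreasing_cvg_mu (mu := mu) mE (bigcupT_measurable _ mE) ndE.
rewrite -(cvg_lim _ cE)//; apply: lime_le; first by apply/cvg_ex; eexists; exact: cE.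
by near=> k; exact: Ev.
Unshelve. all: by end_near. Qed.

Lemma measure_bigcap_ge E v : (forall k, measurable (E k)) -> (mu (E 0%N) < +oo)%E ->
  nonincreasing_seq E -> (forall k, v <= mu (E k))%E ->
  (v <= mu (\bigcap_k E k))%E.
Proof.
move=> mE E0 niE Ev.
have cE := nonincreasing_cvg_mu (mu := mu) E0 mE (bigcapT_measurable mE) niE.
rewrite -(cvg_lim _ cE)//; apply: lime_ge; first by apply/cvg_ex; eexists; exact: cE.
by near=> k; exact: Ev.
Unshelve. all: by end_near. Qed.

(** The median is the infimum of the levels whose sublevel set fills at least half of [F];
    continuity of the measure along monotone sequences gives both inequalities. *)
Lemma measure_median F b : measurable F -> (0 < mu F)%E -> (mu F < +oo)%E ->
  measurable_fun setT b ->
  exists m : R, (mu F <= 2%:E * mu (F `&` [set x | (b x <= m)%R]))%E /\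
                (mu F <= 2%:E * mu (F `&` [set x | (m <= b x)%R]))%E.
Proof.
move=> mF F0 Foo mb.
pose V := fine (mu F) / 2.
have Vfin : mu F \is a fin_num by rewrite ge0_fin_numE// ltW.
have FE : mu F = (fine (mu F))%:E by rewrite fineK.
have F0r : 0 < fine (mu F) by rewrite fine_gt0// F0 Foo.
have V0 : 0 < V by rewrite divr_gt0.
have FV : (V%:E < mu F)%E by rewrite FE lte_fin /V; lra.
have suffV (x : \bar R) : (V%:E <= x)%E -> (mu F <= 2%:E * x)%E.
  by move=> Vx; rewrite -lee_pdivrMl// FE -EFinM mulrC.
pose G s := F `&` [set x | b x <= s].
have mbF : measurable_fun F b by exact: measurable_funTS.
have mG s : measurable (G s) by exact: measurable_sublevel.
have Goo s : (mu (G s) < +oo)%E.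
  by apply: le_lt_trans Foo; apply: le_measure; rewrite ?inE//; exact: subIsetl.
have subG s t : s <= t -> G s `<=` G t.
  by move=> st x [Fx /= bs]; split => //=; exact: le_trans st.
pose A := [set s | (V%:E <= mu (G s))%E].
(* The sets [G k] increase to [F], whose measure exceeds [V]. *)
have [k Ak] : exists k : nat, A k%:R.
  apply: contrapT => /forallNP h; move: FV; apply/negP; rewrite -leNgt.
  rewrite (_ : F = \bigcup_k G k%:R); last first.
    apply/seteqP; split => [x Fx|x [? _ []//]].
    exists (Num.bound `|b x|) => //; split => //=.
    by apply: le_trans (ler_norm _) (ltW (archi_boundP (normr_ge0 _))).
  apply: measure_bigcup_le => // [i j ij|j].
    by apply/subsetPset; apply: subG; rewrite ler_nat.
  by have := h j; rewrite /A/= => /negP; rewrite -ltNge => /ltW.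
(* The sets [G (- l)] decrease to the empty set, so [A] is bounded below. *)
have [l Al] : exists l : nat, (mu (G (- l%:R)%R) < V%:E)%E.
  apply: contrapT => /forallNP h.
  suff : (V%:E <= mu (\bigcap_l G (- l%:R)%R))%E.
    rewrite (_ : \bigcap_l _ = set0) ?measure0 ?lee_fin; first by rewrite leNgt V0.
    apply/seteqP; split => // x /(_ (Num.bound `|b x|).+1 I)[_ /=].
    rewrite lerNr leNgt => /negP; apply.
    apply: le_lt_trans (ler_norm _) _; rewrite normrN.
    by apply: lt_trans (archi_boundP (normr_ge0 _)) _; rewrite ltr_nat.
  apply: measure_bigcap_ge => // [i j ij|j].
    by apply/subsetPset; apply: subG; rewrite lerN2 ler_nat.
  by rewrite leNgt; apply/negP; exact: h.
have lA : lbound A (- l%:R).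
  move=> s As; rewrite leNgt; apply/negP => sl; move: As; apply/negP.
  rewrite -ltNge; apply: le_lt_trans Al.
  by apply: le_measure; rewrite ?inE//; apply: subG; exact: ltW.
have iA : has_inf A by split; [exists k%:R|exists (- l%:R)].
pose m := inf A; exists m; split; apply: suffV.
  (* Right continuity: the sublevel set at [m] is the intersection of those at levels above [m],
     each of measure at least [V]. *)
  rewrite (_ : _ `&` _ = \bigcap_j G (m + j.+1%:R^-1)); last first.
    apply/seteqP; split => [x [Fx /= bx] j _|x Gx].
      by split => //=; apply: le_trans bx _; rewrite lerDl invr_ge0.
    split; first by have [] := Gx 0%N I.
    rewrite /= leNgt; apply/negP => mx.
    have d0 : 0 < b x - m by rewrite subr_gt0.
    have [_ /=] := Gx (Num.bound (b x - m)^-1) I; rewrite leNgt => /negP; apply.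
    rewrite -ltrBrDl invf_plt ?posrE ?ltr0n//.
    apply: (@lt_trans _ _ (Num.bound (b x - m)^-1)%:R); last by rewrite ltr_nat.
    by rewrite archi_boundP// invr_ge0 ltW.
  apply: measure_bigcap_ge => // [i j ij|j].
    apply/subsetPset; apply: subG; rewrite lerD2l lef_pV2 ?posrE ?ltr0n//.
    by rewrite ler_nat.
  have j0 : 0 < j.+1%:R^-1 :> R by rewrite invr_gt0.
  have [s As sm] := inf_adherent j0 iA.
  by apply: le_trans As _; apply: le_measure; rewrite ?inE//; apply: subG; exact: ltW.
(* Levels below [m] are outside [A], so the strict sublevel set at [m], which is this union, has
   measure at most [V]. *)
have ltm : (mu (\bigcup_j G (m - j.+1%:R^-1)%R) <= V%:E)%E.
  apply: measure_bigcup_le => // [i j ij|j].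
    apply/subsetPset; apply: subG; rewrite lerD2l lerN2 lef_pV2 ?posrE ?ltr0n//.
    by rewrite ler_nat.
  rewrite leNgt; apply/negP => /ltW /(ge_inf iA.2); rewrite -/m.
  by rewrite lerBrDr gerDl leNgt invr_gt0 ltr0n.
have mH : measurable (F `&` [set x | m <= b x]) by exact: measurable_superlevel.
have mU : measurable (\bigcup_j G (m - j.+1%:R^-1)) by exact: bigcupT_measurable.
have Foo2 : (mu (F `&` [set x | (m <= b x)%R]) < +oo)%E.
  by apply: le_lt_trans Foo; apply: le_measure; rewrite ?inE//; exact: subIsetl.
have : (mu F <= mu (F `&` [set x | (m <= b x)%R]) + V%:E)%E.
  apply: le_trans (_ : mu ((F `&` [set x | (m <= b x)%R]) `|`
                       (\bigcup_j G (m - j.+1%:R^-1)%R)) <= _)%E.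
    apply: le_measure; rewrite ?inE//; first exact: measurableU.
    move=> x Fx; have [mx|xm] := leP m (b x); [by left|right].
    have d0 : 0 < m - b x by rewrite subr_gt0.
    exists (Num.bound (m - b x)^-1) => //; split => //=.
    rewrite lerBrDl -lerBrDr; apply: ltW; rewrite invf_plt ?posrE ?ltr0n//.
    apply: (@lt_trans _ _ (Num.bound (m - b x)^-1)%:R); last by rewrite ltr_nat.
    by rewrite archi_boundP// invr_ge0 ltW.
  by apply: le_trans (measureU2 _ _ _) _ => //; exact: leeD2l.
have H2 : mu (F `&` [set x | m <= b x]) \is a fin_num by rewrite ge0_fin_numE.
rewrite -(fineK H2) FE -EFinD !lee_fin /V; lra.
Qed.

End median.

(** * Lebesgue outer measure under dilations and reflections, and density in boxes *)

Section lebesgue_outer.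
Context {R : realType} {n : nat}.
Local Notation mu := (@lebesgue_outer R n).
Implicit Types (a b x y z : Rn R n) (A B : set (Rn R n)).

(** A cover of [A] by boxes is carried to a cover of the image, with volumes multiplied by at most
    [K]; it therefore suffices to know [phi] on boxes. *)
Lemma lebesgue_outer_image_le (phi : Rn R n -> Rn R n) (K : R) A :
  0 < K ->
  (forall a b, exists p : Rn R n * Rn R n,
     phi @` box a b `<=` box p.1 p.2 /\
     box_volume p.1 p.2 <= K * box_volume a b) ->
  (mu (phi @` A) <= K%:E * mu A)%E.
Proof.
move=> K0 phibox.
rewrite -lee_pdivrMl//; apply: le_ereal_inf_tmp => _ [F AF <-].
rewrite lee_pdivrMl// -nneseriesZl; last by move=> *; rewrite lee_fin box_volume_ge0.
have [G GP] := choice (fun k => phibox (F k).1 (F k).2).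
apply: (@le_trans _ _ (\sum_(k <oo) (box_volume (G k).1 (G k).2)%:E)%E).
  apply: ereal_inf_lbound; exists G => // _ [x /AF[k _ xk] <-].
  by exists k => //; apply: (GP k).1; exists x.
apply: lee_nneseries => k _; first by rewrite lee_fin box_volume_ge0.
by rewrite -EFinM lee_fin; exact: (GP k).2.
Qed.

Lemma box_setI a b a' b' :
  box a b `&` box a' b' =
  box (\row_i Num.max (a ord0 i) (a' ord0 i) : Rn R n)
      (\row_i Num.min (b ord0 i) (b' ord0 i) : Rn R n).
Proof.
apply/seteqP; split => x /=.
  move=> [h1 h2] i; rewrite !mxE gt_max le_min.
  by case/andP: (h1 i) => -> ->; case/andP: (h2 i) => -> ->.
move=> h; split=> i; have := h i; rewrite !mxE gt_max le_min;
  by case/andP => /andP[? ?] /andP[? ?]; apply/andP.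
Qed.

Lemma lebesgue_outer_box_le a b : (mu (box a b) <= (box_volume a b)%:E)%E.
Proof.
apply: ereal_inf_lbound => /=.
(* The cover is padded with degenerate boxes, of volume 0 because there is at least one
   coordinate. *)
exists (fun k => if k is 0%N then (a, b) else (0, 0)).
  by move=> x bx; exists 0%N.
rewrite (@nneseries_split _ _ 0%N 1%N) ?add0n; last first.
  by move=> *; rewrite lee_fin box_volume_ge0.
rewrite big_nat1 eseries0 ?adde0// => -[|k]//= _ _.
by rewrite /box_volume big_ord_recl subrr maxxx mul0r.
Qed.

Lemma lebesgue_outer_dilation_le (t : R) x A :
  0 < t -> (mu [set (x + t *: z : Rn R n)%R | z in A] <= (t ^+ n.+1)%:E * mu A)%E.
Proof.
move=> t0; apply: lebesgue_outer_image_le => [|a b]; first exact: exprn_gt0.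
exists (x + t *: a, x + t *: b); split=> /=.
  by move=> _ [z zab <-] i; rewrite !mxE ltrD2l lerD2l ltr_pM2l// ler_pM2l.
rewrite le_eqVlt; apply/orP; left; apply/eqP.
rewrite /box_volume -[X in t ^+ X](card_ord n.+1) -prodr_const -big_split/=.
apply: eq_bigr => i _; rewrite !mxE maxr_pMr ?ltW// mulr0.
by congr Num.max; ring.
Qed.

(** The reverse inequality is the same estimate applied to the inverse dilation. *)
Lemma lebesgue_outer_dilation (t : R) x A :
  0 < t -> (mu [set (x + t *: z : Rn R n)%R | z in A] = (t ^+ n.+1)%:E * mu A)%E.
Proof.
move=> t0; apply/eqP; rewrite eq_le lebesgue_outer_dilation_le//=.
rewrite -lee_pdivlMl ?exprn_gt0// -exprVn.
have tV0 : 0 < t^-1 by rewrite invr_gt0.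
have := lebesgue_outer_dilation_le (t^-1) (- (t^-1 *: x))
  [set (x + t *: z : Rn R n) | z in A] tV0.
apply: le_trans; rewrite le_eqVlt; apply/orP; left; apply/eqP; congr (mu _).
rewrite image_comp -[LHS]image_id; apply: eq_imagel => z _ /=.
by rewrite scalerDr addKr scalerA mulVf ?gt_eqF// scale1r.
Qed.

(* A reflected half-open box is half-open on the wrong side, so it is enclosed
   in the half-open box with the same upper corner and twice the sides. *)
Lemma lebesgue_outer_reflection_le (t : R) x A :
  0 < t ->
  (mu [set (x - t *: z : Rn R n)%R | z in A] <= ((2 * t) ^+ n.+1)%:E * mu A)%E.
Proof.
move=> t0; apply: lebesgue_outer_image_le => [|a b].
  by rewrite exprn_gt0// mulr_gt0.
exists (x - t *: (b + b - a), x - t *: a); split=> /=.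
  move=> _ [z zab <-] i; rewrite !mxE ltrD2l lerD2l ltrN2 lerN2.
  rewrite ltr_pM2l// ler_pM2l//; case/andP: (zab i) => az zb.
  by rewrite (ltW az) andbT; lra.
rewrite le_eqVlt; apply/orP; left; apply/eqP.
rewrite /box_volume -[X in _ ^+ X](card_ord n.+1) -prodr_const -big_split/=.
apply: eq_bigr => i _; rewrite !mxE maxr_pMr; last by rewrite mulr_ge0 ?ltW.
by rewrite mulr0; congr Num.max; ring.
Qed.

(** This replaces the Lebesgue density theorem. In a nearly optimal cover of the part of [A] in the
    box, some covering box must be filled by [A] up to the proportion [eta], for otherwise the total
    volume would be too large. Cutting it by [box a b] gives again a box. *)
Lemma lebesgue_outer_dense_box (eta : R) a b A :
  0 < eta -> eta < 1 -> measurable A -> (0 < mu (box a b `&` A))%E ->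
  exists p : Rn R n * Rn R n, [/\ box p.1 p.2 `<=` box a b,
    (0 < mu (box p.1 p.2))%E & (mu (box p.1 p.2 `\` A) <= eta%:E * mu (box p.1 p.2))%E].
Proof.
move=> eta0 eta1 mA m0.
have e1 : 0 < 1 - eta by rewrite subr_gt0.
have moo : (mu (box a b `&` A) < +oo)%E.
  apply: le_lt_trans (ltry (box_volume a b)).
  by apply: le_trans (lebesgue_outer_box_le _ _); apply: le_lebesgue_outer => x [].
have mfin : mu (box a b `&` A) \is a fin_num by rewrite ge0_fin_numE// ltW.
set m := mu (box a b `&` A) in m0 moo mfin.
(* Since [m] is finite and positive, [m / (1 - eta)] exceeds the infimum [m] defining the outer
   measure. *)
have : exists2 F, box_cover (box a b `&` A) F &
   ((1 - eta)%:E * \sum_(k <oo) (box_volume (F k).1 (F k).2)%:E < m)%E.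
  have : (m < ((1 - eta)^-1)%:E * m)%E.
    rewrite -(fineK mfin) -EFinM lte_fin ltr_pMl ?fine_gt0 ?m0 ?moo//.
    by rewrite invf_gt1//; lra.
  move=> /ereal_inf_lt[_ [F FP <-] hF].
  by exists F => //; rewrite -lte_pdivlMl.
move=> [F FP Flt].
have [k hk] : exists k, ((1 - eta)%:E * (box_volume (F k).1 (F k).2)%:E <
    mu (box a b `&` A `&` box (F k).1 (F k).2))%E.
  apply: contrapT => /forallNP h; move: Flt; apply/negP; rewrite -leNgt.
  rewrite -nneseriesZl; last by move=> *; rewrite lee_fin box_volume_ge0.
  apply: (@le_trans _ _ (\sum_(k <oo) mu (box a b `&` A `&` box (F k).1 (F k).2))%E).
    apply: le_trans (outer_measure_sigma_subadditive mu _).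
    by apply: le_lebesgue_outer => x xA; have [k _ xk] := FP _ xA; exists k.
  apply: lee_nneseries => k _; first by move=> _; exact: lebesgue_outer_ge0.
  by rewrite leNgt; apply/negP; exact: h.
have [a' [b' boxE]] : exists a' b',
    box a b `&` box (F k).1 (F k).2 = box a' b'.
  by rewrite box_setI; do 2 eexists.
(* Shrinking the covering box to [box a' b'] keeps its part in [box a b] and [A] and can only
   decrease the left side. *)
have hI : ((1 - eta)%:E * mu (box a' b') < mu (box a' b' `&` A))%E.
  apply: le_lt_trans (_ : (1 - eta)%:E * (box_volume (F k).1 (F k).2)%:E < _)%E.
    apply: lee_wpmul2l; first by rewrite lee_fin ltW.
    apply: le_trans (lebesgue_outer_box_le _ _).
    by rewrite -boxE; apply: le_lebesgue_outer => x [].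
  by move: hk; rewrite -boxE setIAC.
have mufin : mu (box a' b') \is a fin_num.
  rewrite ge0_fin_numE ?lebesgue_outer_ge0//.
  exact: le_lt_trans (lebesgue_outer_box_le _ _) (ltry _).
exists (a', b'); split => /=; first by rewrite -boxE => x [].
- apply: (lt_le_trans (_ : 0 < mu (box a' b' `&` A))%E); last first.
    by apply: le_lebesgue_outer => x [].
  apply: le_lt_trans hI; rewrite mule_ge0 ?lebesgue_outer_ge0//.
  by rewrite lee_fin ltW.
(* Caratheodory measurability of [A] splits the measure of the box, turning the lower bound inside
   [A] into an upper bound outside. *)
- have := mA (box a' b'); rewrite -setDE => mE.
  have : mu (box a' b' `\` A) \is a fin_num.
    rewrite ge0_fin_numE ?lebesgue_outer_ge0//.
    apply: le_lt_trans (_ : mu (box a' b') < _)%E; last by rewrite ltey_eq mufin.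
    by apply: le_lebesgue_outer => x [].
  have : mu (box a' b' `&` A) \is a fin_num.
    rewrite ge0_fin_numE ?lebesgue_outer_ge0//.
    apply: le_lt_trans (_ : mu (box a' b') < _)%E; last by rewrite ltey_eq mufin.
    by apply: le_lebesgue_outer => x [].
  move: hI mE; rewrite -(fineK mufin) => hI mE f1 f2.
  move: hI mE; rewrite -(fineK f1) -(fineK f2) -!EFinM -!EFinD lte_fin lee_fin => hI [mE].
  lra.
Qed.

End lebesgue_outer.

(** * Euclidean norm, directions and homogeneous functions *)

Section euclidean_norm.
Context {R : realType} {n : nat}.
Implicit Types (x y z w : Rn R n) (t : R).

Lemma enorm_ge0 x : 0 <= enorm x.
Proof. exact: sqrtr_ge0. Qed.

Lemma enormZ t x : enorm (t *: x : Rn R n) = `|t| * enorm x.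
Proof.
rewrite /enorm -sqrtr_sqr -sqrtrM ?sqr_ge0// mulr_sumr; congr Num.sqrt.
by apply: eq_bigr => i _; rewrite mxE exprMn.
Qed.

Lemma enormN x : enorm (- x : Rn R n) = enorm x.
Proof. by rewrite -scaleN1r enormZ normrN1 mul1r. Qed.

Lemma measurable_enormB x : measurable_fun setT (fun y : Rn R n => enorm (y - x)).
Proof.
apply: (@measurableT_comp _ _ _ _ _ _ (@Num.sqrt R)).
  by apply: continuous_measurable_fun; exact: sqrt_continuous.
apply: measurable_sum => i; apply: measurable_funX.
rewrite (_ : (fun y : Rn R n => (y - x) ord0 i) = (fun y => y ord0 i - x ord0 i)).
  exact: (measurable_funB (measurable_coord i) (measurable_cst _)).
by apply/funext => y; rewrite !mxE.
Qed.

Lemma le_coord_enorm x i : `|x ord0 i| <= enorm x.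
Proof.
rewrite -sqrtr_sqr /enorm ler_wsqrtr// (bigD1 i)//= lerDl.
by apply: sumr_ge0 => j _; rewrite sqr_ge0.
Qed.

Lemma enorm_eq0 x : (enorm x == 0) = (x == 0).
Proof.
apply/eqP/eqP => [x0|->]; last first.
  by rewrite -(scale0r (0 : Rn R n)) enormZ normr0 mul0r.
apply/rowP => i; rewrite mxE; apply/eqP; rewrite -normr_le0 -x0.
exact: le_coord_enorm.
Qed.

Lemma enorm_gt0 x : (0 < enorm x) = (x != 0).
Proof. by rewrite lt_def enorm_eq0 enorm_ge0 andbT. Qed.

Lemma continuous_enorm : continuous (@enorm R n).
Proof.
move=> x; apply: (@continuous_comp _ _ _ _ Num.sqrt); last exact: sqrt_continuous.
suff /(_ x) : continuous (fun y : Rn R n => \sum_(i < n.+1) y ord0 i ^+ 2) by [].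
apply: continuous_big => [|i _ {}x]; first exact: add_continuous.
apply: (@continuous_comp _ _ _ _ (fun r : R => r ^+ 2)); last exact: exprn_continuous.
exact: coord_continuous.
Qed.

Lemma direction_continuous_at x : x != 0 -> {for x, continuous (@direction R n)}.
Proof.
move=> x0; apply: (@cvgZ _ _ _ _ (nbhs_filter x)); last exact: cvg_id.
apply: (@cvgV _ _ _ (nbhs_filter x)); first by rewrite enorm_eq0.
exact: continuous_enorm.
Qed.

Lemma sphere_direction x : sphere (direction x) <-> x <> 0.
Proof.
rewrite /sphere/= /direction enormZ; split => [|/eqP]; last first.
  by rewrite -enorm_gt0 => x0; rewrite ger0_norm ?invr_ge0 ?ltW// mulVf ?gt_eqF.
move=> /[swap] ->; have /eqP-> : enorm (0 : Rn R n) == 0 by rewrite enorm_eq0.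
by rewrite mulr0 => /eqP; rewrite eq_sym oner_eq0.
Qed.

Lemma directionZ t x : 0 < t -> direction (t *: x : Rn R n) = direction x.
Proof.
move=> t0; rewrite /direction enormZ gtr0_norm// invfM scalerA mulrAC.
by rewrite mulVf ?gt_eqF// mul1r.
Qed.

Lemma homogeneous_direction (Om : Rn R n -> R) x :
  homogeneous_degree0 Om -> x != 0 -> Om (direction x) = Om x.
Proof.
move=> hOm x0; rewrite -(hOm (enorm x)) ?enorm_gt0//.
  by rewrite scalerA divff ?scale1r// enorm_eq0.
by apply/sphere_direction/eqP.
Qed.

Lemma homogeneousZ (Om : Rn R n -> R) t x :
  homogeneous_degree0 Om -> 0 < t -> x != 0 -> Om (t *: x) = Om x.
Proof.
move=> hOm t0 x0; rewrite -homogeneous_direction//.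
  by rewrite directionZ// homogeneous_direction.
by rewrite scaler_eq0 gt_eqF.
Qed.

(** Around each point, the sup-norm ball contained in [D] contains a box with rational corners
    around that point, and such boxes are countably many. *)
Lemma open_bigcup_box (D : set (Rn R n)) : open D ->
  exists F : nat -> Rn R n * Rn R n, D = \bigcup_k box (F k).1 (F k).2.
Proof.
move=> oD.
pose c (p : 'rV[rat]_n.+1) : Rn R n := \row_i ratr (p ord0 i).
(* Codes that yield no box inside [D] are sent to [(0, 0)], whose box is empty. *)
pose F k : Rn R n * Rn R n :=
  if unpickle k is Some p then
    if `[< box (c p.1) (c p.2) `<=` D >] then (c p.1, c p.2) else (0, 0)
  else (0, 0).
exists F; apply/seteqP; split => [z Dz|z [k _]]; last first.
  rewrite /F; case: unpickle => [p|].
    case: asboolP => [h|_]; first exact: h.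
    by move/(_ ord0); case/andP => /lt_le_trans /[apply]; rewrite ltxx.
  by move/(_ ord0); case/andP => /lt_le_trans /[apply]; rewrite ltxx.
have /nbhs_ballP[e /= e0 De] : nbhs z D by rewrite openE in oD; exact: oD.
have lo i : z ord0 i - e < z ord0 i by rewrite ltrBlDr ltrDl.
have hi i : z ord0 i < z ord0 i + e by rewrite ltrDl.
have [p pP] := choice (fun i => rat_in_itvoo (lo i)).
have [q qP] := choice (fun i => rat_in_itvoo (hi i)).
exists (pickle (\row_i p i, \row_i q i)) => //; rewrite /F pickleK /=.
case: asboolP => /= [_ i|]; last first.
  case=> y yb; apply: De; rewrite mx_norm_ball /ball_/= {1}/normr/= mx_normrE.
  apply/bigmax_ltP; split => // -[i j] _ /=; rewrite (ord1 i) !mxE.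
  have := yb j; have := pP j; have := qP j; rewrite !mxE !in_itv/=.
  by rewrite ltr_norml => /andP[? ?] /andP[? ?] /andP[? ?]; apply/andP; split; lra.
have := pP i; have := qP i; rewrite !mxE !in_itv/=.
by move=> /andP[/ltW -> _] /andP[_ ->].
Qed.

End euclidean_norm.

(** * Null sets of the sphere, cones over them, and a box where the kernel has a sign *)

Section cones.
Context {R : realType} {n : nat}.
Local Notation mu := (@lebesgue_outer R n).
Local Notation S := (direction_space R n).
Implicit Types (x y z w : Rn R n) (t : R).

Lemma lebesgue_outer_null_measurable (A : set (Rn R n)) :
  mu A = 0%E -> measurable A.
Proof.
move=> A0; apply: (@le_caratheodory_measurable _ _ mu) => X.
suff XA : mu (X `&` A) = 0%E.
  change (mu (X `&` A) + mu (X `&` ~` A) <= mu X)%E.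
  by rewrite XA add0e; apply: le_lebesgue_outer => x [].
apply/eqP; rewrite eq_le lebesgue_outer_ge0 andbT -A0.
by apply: le_lebesgue_outer => x [].
Qed.

Lemma lebesgue_outer_bigcup_null (A : (set (Rn R n))^nat) :
  (forall k, mu (A k) = 0%E) -> mu (\bigcup_k A k) = 0%E.
Proof.
move=> A0; apply/eqP; rewrite eq_le lebesgue_outer_ge0 andbT.
apply: le_trans (outer_measure_sigma_subadditive mu A) _.
by rewrite eseries0// => k _ _; exact: A0.
Qed.

Lemma lebesgue_outerU (A B : set (Rn R n)) : (mu (A `|` B) <= mu A + mu B)%E.
Proof. exact: (outer_measureU2 mu). Qed.

Lemma lebesgue_outer_subnull (A B : set (Rn R n)) :
  A `<=` B -> mu B = 0%E -> mu A = 0%E.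
Proof.
move=> AB B0; apply/eqP; rewrite eq_le lebesgue_outer_ge0 andbT -B0.
exact: le_lebesgue_outer.
Qed.

(** [sphere_measure] sees only the part of the cone in the unit ball, and the integer dilates of
    that part exhaust the cone. The origin is removed because its [direction] is 0 by convention,
    which may belong to [A]. *)
Lemma cone_null (A : set S) : sphere_measure A = 0%E ->
  mu ((@direction R n @^-1` A) `\ 0) = 0%E.
Proof.
move=> A0.
have m1 : mu (@direction R n @^-1` A `&` [set x | 0 < enorm x < 1]) = 0%E.
  by move/eqP: A0; rewrite mule_eq0 => /orP[|/eqP//]; rewrite eqe pnatr_eq0.
apply: (@lebesgue_outer_subnull _ (\bigcup_k
  [set (0 + k.+1%:R *: z : Rn R n) |
   z in (@direction R n @^-1` A `&` [set x | 0 < enorm x < 1])])).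
  move=> x [Ax /eqP x0]; have xk := archi_boundP (enorm_ge0 x).
  have k0 : 0 < (Num.bound (enorm x)).+1%:R :> R by rewrite ltr0n.
  exists (Num.bound (enorm x)) => //; exists ((Num.bound (enorm x)).+1%:R^-1 *: x).
    split; first by rewrite /= directionZ// invr_gt0.
    rewrite /= enormZ gtr0_norm ?invr_gt0// mulr_gt0 ?invr_gt0 ?enorm_gt0//=.
    by rewrite ltr_pdivrMl// mulr1 (lt_trans xk)// ltr_nat.
  by rewrite add0r scalerA mulfV ?gt_eqF// scale1r.
apply: lebesgue_outer_bigcup_null => k.
by rewrite lebesgue_outer_dilation ?ltr0n// m1 mule0.
Qed.

(** A converse for arbitrary [A]: null sets are Lebesgue measurable, which makes the set
    [cone_measurable]. Intersecting with [sphere] discards the origin, whose direction is 0. *)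
Lemma null_cone (A : set S) : mu ((@direction R n @^-1` A) `\ 0) = 0%E ->
  (@sphere_measure R n).-negligible (A `&` sphere).
Proof.
move=> A0; exists (A `&` sphere).
have dA : @direction R n @^-1` (A `&` sphere) = (@direction R n @^-1` A) `\ 0.
  by apply/seteqP; split=> x [Ax /sphere_direction x0].
split => //.
- rewrite [measurable _]/(measurable (@direction R n @^-1` (A `&` sphere))) dA.
  exact: lebesgue_outer_null_measurable.
- rewrite /sphere_measure dA /leb (@lebesgue_outer_subnull _ _ _ A0) ?mule0//.
Qed.

Lemma measurable_sphere : measurable (sphere : set S).
Proof.
change (measurable (@direction R n @^-1` sphere : set (Rn R n))).
rewrite (_ : _ @^-1` _ = @enorm R n @^-1` (~` [set 0])).
  by rewrite -[X in measurable X]setTI; apply: measurable_enorm => //; exact: measurableC.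
apply/seteqP; split => x.
  by move/sphere_direction => x0 /= /eqP; rewrite enorm_eq0 => /eqP.
by move=> /= /eqP; rewrite enorm_eq0 => /eqP x0; exact/sphere_direction.
Qed.

Lemma measurable_cone_level (Om : S -> R) (e : R) :
  homogeneous_degree0 Om -> measurable_fun (sphere : set S) Om ->
  measurable [set w : Rn R n | w <> 0 /\ e <= Om w].
Proof.
move=> hOm mOm.
have : measurable
    (@direction R n @^-1` (sphere `&` Om @^-1` `[e, +oo[%classic) : set (Rn R n)).
  exact: (mOm measurable_sphere _ (measurable_itv `[e, +oo[)).
congr measurable; apply/seteqP; split => x /=.
  move=> [/sphere_direction x0]; rewrite in_itv/= andbT.
  by rewrite homogeneous_direction//; exact/eqP.
move=> [x0]; rewrite in_itv/= andbT; split; first exact/sphere_direction.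
by rewrite homogeneous_direction//; exact/eqP.
Qed.

(** The bound [delta] keeps the box away from the singularity of the kernel; [eta] is the proportion
    of bad points, where [Om] is below [e]. *)
Definition sign_box (Om : Rn R n -> R) (eta e delta : R)
    (p : Rn R n * Rn R n) : Prop :=
  [/\ 0 < e, 0 < delta, (forall w, box p.1 p.2 w -> delta < enorm w),
    (0 < mu (box p.1 p.2))%E &
    mu (box p.1 p.2 `&` [set w | Om w < 0%R]) = 0%E /\
    (mu (box p.1 p.2 `&` [set w | (Om w < e)%R]) <= eta%:E * mu (box p.1 p.2))%E].

(** [Om] is not almost everywhere 0 on the given part of the sphere, so it exceeds some positive
    level on a set of positive measure in the open cone over it. One of the countably many boxes
    filling the cone meets this set in positive measure, and a subbox is nearly filled by it. *)
Lemma exists_sign_box (Om : S -> R) (U : set (Rn R n)) (eta : R) :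
  homogeneous_degree0 Om -> measurable_fun (sphere : set S) Om -> open U ->
  {ae @sphere_measure R n, forall x, (U `&` sphere) x -> 0 <= Om x} ->
  ~ {ae @sphere_measure R n, forall x, (U `&` sphere) x -> Om x = 0} ->
  0 < eta -> eta < 1 ->
  exists (e delta : R) (p : Rn R n * Rn R n), sign_box Om eta e delta p.
Proof.
move=> hOm mOm oU ae0 Nae0 eta0 eta1.
(* The open sets [D k] exhaust the cone without the origin, and the sets [L k] below exhaust the
   points where [Om] is positive. *)
pose D (k : nat) : set (Rn R n) :=
  [set z | U (direction z) /\ k.+1%:R^-1 < enorm z].
have Dn0 k z : D k z -> z <> 0.
  by move=> [_ zk]; apply/eqP; rewrite -enorm_gt0; apply: lt_trans zk; rewrite invr_gt0.
have oD k : open (D k).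
  rewrite openE => z Dz; have /eqP z0 := Dn0 _ _ Dz.
  case: Dz => Uz kz.
  have zU : nbhs z (@direction R n @^-1` U).
    exact: (direction_continuous_at z z0 U (open_nbhs_nbhs (conj oU Uz))).
  have zk : nbhs z (@enorm R n @^-1` [set r | k.+1%:R^-1 < r]).
    have : nbhs (enorm z) [set r | k.+1%:R^-1 < r].
      apply: open_nbhs_nbhs; split => //; exact: open_gt.
    exact: (continuous_enorm z).
  exact: filterI zU zk.
pose L (k : nat) : set (Rn R n) := [set w | w <> 0 /\ k.+1%:R^-1 <= Om w].
have mL k : measurable (L k) by exact: measurable_cone_level.
have neg0 k : mu (D k `&` [set w | Om w < 0]) = 0%E.
  case: ae0 => N' [mN' N'0 sN'].
  apply: lebesgue_outer_subnull (cone_null N' N'0) => w [Dw Omw].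
  have w0 := Dn0 _ _ Dw; split; last exact: w0.
  apply: sN' => /= h; have := h _; rewrite homogeneous_direction//; last exact/eqP.
  have /[swap] /[apply] : (U `&` sphere) (direction w).
    by split; [exact: Dw.1|exact/sphere_direction].
  by rewrite leNgt Omw.
have [k Lk] : exists k, (0 < mu (D k `&` L k))%E.
  apply: contrapT => /forallNP h; apply: Nae0.
  apply: negligibleS (null_cone [set x | U x /\ Om x <> 0] _).
    by move=> x /= /not_implyP[[Ux Sx] Omx].
  apply: lebesgue_outer_subnull (_ : mu (\bigcup_k ((D k `&` L k) `|`
     (D k `&` [set w | Om w < 0]))) = 0%E).
    move=> x [[Ux Omx]]; move=> /eqP x0.
    have Omx' : Om x != 0.
      by apply/eqP; rewrite -(homogeneous_direction _ _ hOm x0).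
    have xe : 0 < enorm x by rewrite enorm_gt0.
    (* An index [k] with [1 / (k + 1) < r] puts [x] in [D k] and, unless [Om x] is negative, in
       [L k] as well. *)
    pose r := Num.min (enorm x) `|Om x|.
    have r0 : 0 < r by rewrite lt_min xe normr_gt0.
    have rk := archi_boundP (ltW (_ : 0 < r^-1)).
    have {}rk : (Num.bound r^-1).+1%:R^-1 < r.
      rewrite invf_plt ?posrE ?ltr0n//; apply: lt_trans (rk _) _; rewrite ?invr_gt0//.
      by rewrite ltr_nat.
    exists (Num.bound r^-1) => //; have Dx : D (Num.bound r^-1) x.
      by split => //; apply: lt_le_trans rk _; rewrite ge_min lexx.
    case: (ltP (Om x) 0) => Om0; first by right.
    left; split => //; split; first exact/eqP.
    by apply: (le_trans (ltW rk)); rewrite ge_min ger0_norm// lexx orbT.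
  apply: lebesgue_outer_bigcup_null => k.
  apply/eqP; rewrite eq_le lebesgue_outer_ge0 andbT.
  apply: le_trans (lebesgue_outerU _ _) _.
  rewrite neg0 adde0; move: (h k).
  by rewrite lt_def lebesgue_outer_ge0 andbT => /negP/negPn/eqP->.
have [F DF] := open_bigcup_box _ (oD k).
have [j Lj] : exists j, (0 < mu (box (F j).1 (F j).2 `&` L k))%E.
  apply: contrapT => /forallNP h; move: Lk; rewrite DF setI_bigcupl.
  rewrite lebesgue_outer_bigcup_null ?ltxx// => j; move: (h j).
  by rewrite lt_def lebesgue_outer_ge0 andbT => /negP/negPn/eqP.
have [p [pF p0 pL]] := lebesgue_outer_dense_box eta _ _ _ eta0 eta1 (mL k) Lj.
have pD : box p.1 p.2 `<=` D k.
  by apply: subset_trans pF _; rewrite DF => w wj; exists j.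
(* The same number serves as level for [L k] and as distance to the origin for [D k]. *)
exists k.+1%:R^-1, k.+1%:R^-1, p; split; rewrite ?invr_gt0//.
  by move=> w /pD[].
split.
  by apply: lebesgue_outer_subnull (neg0 k); exact: setSI.
apply: le_trans pL; apply: le_lebesgue_outer => w [pw /= wk]; split => // -[_].
by rewrite leNgt wk.
Qed.

End cones.

(** * Pointwise lower bound for the commutator of an indicator *)

Section commutator_indicator.
Context {R : realType} {n : nat}.
Local Notation mu := (@lebesgue_outer R n).
Implicit Types (b h Om : Rn R n -> R) (x y : Rn R n) (F : set (Rn R n)).

Lemma measurable_annulus x (e : R) : measurable (annulus x e).
Proof.
have := measurable_enormB x measurableT _ (measurable_itv `]e, e^-1[); rewrite setTI.
congr measurable; apply/seteqP; split => y;
  by rewrite /annulus/= in_itv/= -(enormN (x - y)) opprB.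
Qed.

(** Once the truncation parameter is below [e], its annulus contains [F]: the truncated integrals
    are eventually constant and the principal value is an ordinary integral. *)
Lemma singular_integral_support Om h F x (e : R) :
  0 < e -> F `<=` annulus x e -> (forall y, ~ F y -> h y = 0) ->
  singular_integral Om h x = \int[leb]_(y in F) integrand Om h x y.
Proof.
move=> e0 Fe h0; apply: cvg_lim => //; apply: cvg_near_cst.
near=> r; rewrite /truncated Rintegral_mkcond [RHS]Rintegral_mkcond.
apply: eq_Rintegral => y _; rewrite !patchE.
have [Fy|Fy] := pselect (F y); last first.
  by rewrite [in RHS]memNset//; case: ifP => //; rewrite /integrand h0 ?mulr0.
rewrite [in RHS]mem_set// mem_set//.
have r0 : 0 < r by [].
have re : r <= e by near: r; exact: nbhs_right_le.
case/andP: (Fe _ Fy) => ey ye; rewrite /annulus/= (le_lt_trans re ey)/=.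
by apply: lt_le_trans ye _; rewrite lef_pV2.
Unshelve. all: by end_near. Qed.

(** Away from [F] the commutator is one integral of [c (b x - b y)] against the kernel. Up to the
    sign [tau * sg] the integrand is nonnegative almost everywhere, and it is at least
    [d c eps / M ^ (n + 1)] off a bad set of measure at most [u]; Markov's inequality concludes. *)
Lemma commutator_lower_bound Om b F x (c d eps M e v u sg tau : R) :
  measurable F -> 0 < e -> F `<=` annulus x e ->
  singular_integral_exists Om (fun y => c * \1_F y) x ->
  singular_integral_exists Om (fun y => b y * (c * \1_F y)) x ->
  `|sg| = 1 -> `|tau| = 1 -> 0 <= c -> 0 <= d -> 0 <= eps -> 0 < M ->
  (forall y, F y -> d <= tau * (b x - b y)) ->
  (forall y, F y -> enorm (x - y) <= M) ->
  mu (F `&` [set y | sg * Om (x - y) < 0]) = 0%E ->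
  (v%:E <= leb F)%E ->
  (mu (F `&` [set y | (sg * Om (x - y) < eps)%R]) <= u%:E)%E ->
  d * c * (eps / M ^+ n.+1) * (v - u) <=
    `|commutator b Om (fun y => c * \1_F y) x|.
Proof.
move=> mF e0 Fe [i1 _] [i2 _] sg1 tau1 c0 d0 eps0 M0 Fd FM neg0 Fv Fu.
have {}i1 := integrableS (measurable_annulus x e) mF Fe (i1 _ e0).
have {}i2 := integrableS (measurable_annulus x e) mF Fe (i2 _ e0).
rewrite /commutator !(singular_integral_support _ _ F x e)//; last 2 first.
- by move=> y Fy; rewrite indicE memNset// !mulr0.
- by move=> y Fy; rewrite indicE memNset// mulr0.
rewrite -RintegralZl//.
have i1' : leb.-integrable F (EFin \o (fun y => b x * integrand Om (fun y => c * \1_F y) x y)).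
  exact: (integrableZl mF (b x) i1).
rewrite -RintegralB//.
pose H y := b x * integrand Om (fun y => c * \1_F y) x y -
            integrand Om (fun y => b y * (c * \1_F y)) x y.
have iH : leb.-integrable F (EFin \o H).
  exact: (integrableB mF i1' i2).
pose J y := (tau * sg) * H y.
have iJ : leb.-integrable F (EFin \o J).
  exact: (integrableZl mF (tau * sg) iH).
have JE y : F y -> J y = tau * (b x - b y) * c * (sg * Om (x - y) / enorm (x - y) ^+ n.+1).
  by move=> Fy; rewrite /J /H /integrand indicE mem_set//= mulr1; ring.
have xy0 y : F y -> 0 < enorm (x - y).
  by move=> /Fe/andP[ey _]; exact: lt_trans ey.
have J0 : {ae leb, forall y, F y -> 0 <= J y}.
  exists (F `&` [set y | sg * Om (x - y) < 0]); split => //.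
    exact: lebesgue_outer_null_measurable.
  move=> y /= /not_implyP[Fy /negP]; rewrite -ltNge => Jy; split => //=.
  rewrite ltNge; apply: contraTN Jy => Oy; rewrite -leNgt JE//.
  rewrite mulr_ge0// ?divr_ge0 ?exprn_ge0 ?enorm_ge0//.
  by rewrite mulr_ge0// (le_trans d0)// Fd.
pose q := d * c * (eps / M ^+ n.+1).
have q0 : 0 <= q by rewrite /q !mulr_ge0// invr_ge0 exprn_ge0// ltW.
have := markov_Rintegral _ _ _ _ _ _ q mF iJ J0 q0.
set W := F `&` _ => qW.
(* A point of [F] where [sg * Om (x - y)] is at least [eps] lies in [W], so [W] loses at most [u]
   from [F]. *)
have mW : ((v - u)%:E <= leb W)%E.
  rewrite EFinB leeBlDr//; apply: le_trans Fv _.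
  have : F `<=` W `|` (F `&` [set y | sg * Om (x - y) < eps]).
    move=> y Fy; have [Oy|Oy] := ltP (sg * Om (x - y)) eps; [by right|left].
    split => //=; rewrite JE// /q; apply: ler_pM; [exact: mulr_ge0| |exact/ler_wpM2r/Fd|].
      by rewrite divr_ge0// exprn_ge0// ltW.
    apply: ler_pM => //; first by rewrite invr_ge0 exprn_ge0// ltW.
    by rewrite lef_pV2 ?posrE ?exprn_gt0 ?xy0// lerXn2r ?nnegrE ?FM// ltW ?xy0.
  move/le_lebesgue_outer/le_trans; apply.
  by apply: le_trans (lebesgue_outerU _ _) _; exact: leeD2l.
have : q * (v - u) <= \int[leb]_(y in F) J y.
  by rewrite -lee_fin; apply: le_trans qW; rewrite EFinM; exact: lee_wpmul2l.
move=> /le_trans; apply.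
rewrite RintegralZl//; apply: le_trans (ler_norm _) _.
by rewrite !normrM sg1 tau1 !mul1r.
Qed.

End commutator_indicator.

(** * Measurability, size and doubling of Euclidean balls *)

Section balls.
Context {R : realType} {n : nat}.
Local Notation mu := (@lebesgue_outer R n).
Implicit Types (x y a b : Rn R n) (r : R).

Lemma measurable_coord_box (I : 'I_n.+1 -> set R) :
  (forall i, measurable (I i)) -> measurable [set y : Rn R n | forall i, I i (y ord0 i)].
Proof.
move=> mI; rewrite (_ : mkset _ =
    \bigcap_(i in [set: 'I_n.+1]) ((fun y : Rn R n => y ord0 i) @^-1` I i)).
  apply: fin_bigcap_measurable => [|i _]; first exact: finite_finset.
  by rewrite -[X in measurable X]setTI; exact: measurable_coord.
by apply/seteqP; split => y /= h i => [_|]; exact: h.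
Qed.

Lemma measurable_box a b : measurable (box a b).
Proof.
have := measurable_coord_box (fun i => `]a ord0 i, b ord0 i]%classic) (fun=> measurable_itv _).
by congr measurable; apply/seteqP; split => y /= h i; have := h i; rewrite in_itv.
Qed.

Lemma measurable_eball x r : measurable (eball x r).
Proof.
have := measurable_enormB x measurableT _ (measurable_itv `]-oo, r[); rewrite setTI.
by congr measurable; apply/seteqP; split => y /=; rewrite in_itv.
Qed.

Lemma eballP x r y : eball x r y -> forall i, `|y ord0 i - x ord0 i| < r.
Proof.
by move=> xy i; apply: le_lt_trans xy; have := le_coord_enorm (y - x) i; rewrite !mxE.
Qed.

Lemma leb_eball_fin x r : (leb (eball x r) < +oo)%E.
Proof.
apply: le_lt_trans (ltry (box_volume (x - const_mx r) (x + const_mx r))).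
apply: le_trans (lebesgue_outer_box_le _ _); apply: le_lebesgue_outer => y /eballP xy i.
by have := xy i; rewrite !mxE ltr_norml => /andP[? ?]; apply/andP; split; lra.
Qed.

Lemma leb_eball_scale_le x r k : 0 < k ->
  (leb (eball x (k * r)) <= (k ^+ n.+1)%:E * leb (eball x r))%E.
Proof.
move=> k0; have := lebesgue_outer_dilation k (x - k *: x) (eball x r) k0.
rewrite /leb => <-; apply: le_lebesgue_outer => y xy.
exists (x + k^-1 *: (y - x)).
  rewrite /eball/= addrAC subrr add0r enormZ gtr0_norm ?invr_gt0//.
  by rewrite ltr_pdivrMl.
by rewrite scalerDr scalerA mulfV ?gt_eqF// scale1r addrA subrK addrC subrK.
Qed.

Lemma locally_integrable_eball (f : Rn R n -> R) x r : locally_integrable_Rn f ->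
  leb.-integrable (eball x r) (EFin \o f).
Proof.
move=> [mf fK].
pose K : set (Rn R n) := [set y | forall i, `[x ord0 i - r, x ord0 i + r]%classic (y ord0 i)].
have cK : compact K.
  apply: (@rV_compact R n.+1 (fun i => `[x ord0 i - r, x ord0 i + r]%classic)) => i.
  exact: segment_compact.
have mfn : measurable_fun setT (fun y : Rn R n => `|f y|%:E).
  by apply/measurable_EFinP; exact: measurableT_comp mf.
have mB := measurable_eball x r.
apply/integrableP; split.
  by apply/measurable_EFinP; exact: measurable_funS mf.
apply: le_lt_trans (fK K cK).
apply: ge0_subset_integral => //.
- exact: (measurable_coord_box (fun i => `[x ord0 i - r, x ord0 i + r]%classic)).
- exact: measurable_funS mfn.
- move=> y /eballP xy i /=; have := xy i; rewrite in_itv/= ltr_norml.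
  by move=> /andP[? ?]; apply/andP; split; lra.
Qed.

End balls.

(** * Construction of the test set attached to a ball *)

Section test_set.
Context {R : realType} {n : nat}.
Local Notation mu := (@lebesgue_outer R n).
Implicit Types (x y a b : Rn R n) (r : R).

Lemma enorm_box_le a b w : box a b w ->
  enorm w <= Num.sqrt (\sum_(i < n.+1) (a ord0 i ^+ 2 + b ord0 i ^+ 2)).
Proof.
move=> abw; rewrite ler_wsqrtr//; apply: ler_sum => i _.
case/andP: (abw i) => aw wb; have [w0|w0] := leP 0 (w ord0 i).
  have : w ord0 i ^+ 2 <= b ord0 i ^+ 2 by rewrite ler_sqr ?nnegrE// (le_trans w0).
  by move/le_trans; apply; rewrite lerDr sqr_ge0.
have : w ord0 i ^+ 2 <= a ord0 i ^+ 2.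
  by rewrite -sqrrN -[leRHS]sqrrN ler_sqr ?nnegrE ?oppr_ge0 ?lerN2 ltW// (lt_trans aw).
by move/le_trans; apply; rewrite lerDl sqr_ge0.
Qed.

(** For [y] in the reflected middle half, [x0 - y] keeps a margin of a quarter of each side of the
    dilated box; moving from [x0] to [x] costs less than [r], which this margin absorbs. *)
Lemma box_middle_translate (a b x0 x y : Rn R n) (t r : R) : 0 < t ->
  (forall i, r <= t * (4^-1 * (b ord0 i - a ord0 i))) ->
  box (x0 - t *: (b - 4^-1 *: (b - a))) (x0 - t *: (a + 4^-1 *: (b - a))) y ->
  eball x0 r x -> box a b (t^-1 *: (x - y)).
Proof.
move=> t0 tr ymid /eballP xr i; have := ymid i; have := xr i; have := tr i.
rewrite !mxE ltr_norml => h /andP[h1 h2] /andP[h3 h4].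
rewrite ltr_pdivlMl// ler_pdivrMl//; apply/andP; split; nra.
Qed.

Lemma box_nonempty_lt a b w : box a b w -> forall i, a ord0 i < b ord0 i.
Proof. by move=> abw i; case/andP: (abw i); exact: lt_le_trans. Qed.

(** [F] stands for either part of [A] cut by a median of [b], [tau] for the sign of [b x - b y]
    there, and [c] for the factor normalizing the indicator in the space. [kappa] depends on none of
    them. *)
Definition commutator_test_set (Om : Rn R n -> R) (kappa : R)
    (A B : set (Rn R n)) : Prop :=
  forall (b : Rn R n -> R) (F : set (Rn R n)) (c d tau : R) x,
    measurable F -> F `<=` A -> (leb A <= 2%:E * leb F)%E -> B x ->
    `|tau| = 1 -> 0 <= c -> 0 <= d -> (forall y, F y -> d <= tau * (b x - b y)) ->
    singular_integral_exists Om (fun y => c * \1_F y) x ->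
    singular_integral_exists Om (fun y => b y * (c * \1_F y)) x ->
    d * c * kappa <= `|commutator b Om (fun y => c * \1_F y) x|.

(* The proportion [4 ^- n.+2] of bad points in the box is multiplied by at most
   [2 ^+ n.+1] under reflection and by [2 ^+ n.+1] when restricting to the middle
   half, which leaves a quarter; a set [F] filling half of [A] keeps a quarter. *)
Lemma exists_commutator_test_set (Om : Rn R n -> R) (sg e delta : R)
    (p : Rn R n * Rn R n) :
  homogeneous_degree0 Om -> `|sg| = 1 ->
  sign_box (fun w => sg * Om w) (4 ^+ n.+2)^-1 e delta p ->
  exists kappa rho : R, [/\ 0 < kappa, 0 < rho & forall x0 r, 0 < r ->
    exists A : set (Rn R n), [/\ measurable A, A `<=` eball x0 (rho * r),
      (0 < leb A)%E & commutator_test_set Om kappa A (eball x0 r)] ].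
Proof.
case: p => a b hOm sg1 [/= e0 delta0 Qdelta Q0 [Qneg Qe]].
set Q := box a b in Qdelta Q0 Qneg Qe.
have Qfin : mu Q \is a fin_num.
  rewrite ge0_fin_numE ?lebesgue_outer_ge0//.
  exact: le_lt_trans (lebesgue_outer_box_le _ _) (ltry _).
have [q qE] : exists q, mu Q = q%:E by exists (fine (mu Q)); rewrite fineK.
have q0 : 0 < q by move: Q0; rewrite qE lte_fin.
have ab i : a ord0 i < b ord0 i.
  have [w Qw] : Q !=set0.
    by apply/set0P; apply: contraTneq Q0 => ->; rewrite lebesgue_outer0 ltxx.
  exact: box_nonempty_lt Qw i.
(* A sum dominates each of its terms, so the dilation factor [t = tau0 * r] meets the margin
   condition in every coordinate at once. *)
pose tau0 : R := \sum_(i < n.+1) 4 / (b ord0 i - a ord0 i).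
have tau0i i : 4 / (b ord0 i - a ord0 i) <= tau0.
  rewrite /tau0 (bigD1 i)//= lerDl; apply: sumr_ge0 => j _.
  by rewrite divr_ge0// subr_ge0 ltW.
have tau00 : 0 < tau0.
  by apply: lt_le_trans (tau0i ord0); rewrite divr_gt0// subr_gt0.
pose L : R := 1 + Num.sqrt (\sum_(i < n.+1) (a ord0 i ^+ 2 + b ord0 i ^+ 2)).
have L0 : 0 < L by rewrite ltr_pwDl// sqrtr_ge0.
have QL w : Q w -> enorm w < L.
  by move/enorm_box_le => wL; rewrite /L; lra.
(* This [kappa] is the kernel bound [e / (t L) ^ (n + 1)] times a quarter of the least measure
   [(t / 2) ^ (n + 1) q] of the test box; the powers of [t] cancel, hence independence of the
   ball. *)
exists (e * q / (4 * (2 * L) ^+ n.+1)), (tau0 * L); split.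
- by rewrite divr_gt0 ?mulr_gt0 ?exprn_gt0// mulr_gt0.
- exact: mulr_gt0.
move=> x0 r r0; pose t := tau0 * r.
have t0 : 0 < t by exact: mulr_gt0.
have tr i : r <= t * (4^-1 * (b ord0 i - a ord0 i)).
  rewrite -[leLHS]mul1r /t mulrAC ler_pM2r// -ler_pdivrMr; last first.
    by rewrite mulr_gt0 ?invr_gt0// subr_gt0.
  by rewrite invfM invrK mul1r; exact: tau0i.
pose lo : Rn R n := x0 - t *: (b - 4^-1 *: (b - a)).
pose hi : Rn R n := x0 - t *: (a + 4^-1 *: (b - a)).
have inQ x y : box lo hi y -> eball x0 r x -> Q (t^-1 *: (x - y)).
  exact: box_middle_translate.
have x0B : eball x0 r x0.
  by rewrite /eball/= subrr -(scale0r (0 : Rn R n)) enormZ normr0 mul0r.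
(* The test box has sides [t / 2] times those of [Q], so it is compared with a translated dilate of
   [Q] without any reflection. *)
have lohi : (((t / 2) ^+ n.+1 * q)%:E <= mu (box lo hi))%E.
  rewrite EFinM -qE -(lebesgue_outer_dilation (t / 2) (lo - (t / 2) *: a)) ?divr_gt0//.
  apply: le_lebesgue_outer => _ [z Qz <-] i; have := Qz i; have := ab i.
  rewrite /lo /hi !mxE => h /andP[h1 h2]; apply/andP; split; nra.
exists (box lo hi); split; first exact: measurable_box.
- move=> y /inQ /(_ x0B) /QL; rewrite enormZ gtr0_norm ?invr_gt0//.
  by rewrite ltr_pdivrMl// /eball/= -(enormN (x0 - y)) opprB mulrAC.
- by apply: lt_le_trans lohi; rewrite lte_fin mulr_gt0// exprn_gt0// divr_gt0.
have Afin : mu (box lo hi) \is a fin_num.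
  rewrite ge0_fin_numE ?lebesgue_outer_ge0//.
  exact: le_lt_trans (lebesgue_outer_box_le _ _) (ltry _).
have [v vE] : exists v, mu (box lo hi) = v%:E.
  by exists (fine (mu (box lo hi))); rewrite fineK.
move: lohi; rewrite vE lee_fin => lohi.
move=> b' F c d tau x mF FA AF xB tau1 c0 d0 Fd i1 i2.
have xyE y : x - y = t *: (t^-1 *: (x - y)) by rewrite scalerA mulfV ?gt_eqF// scale1r.
have xy y : F y -> Q (t^-1 *: (x - y)) by move=> Fy; apply: inQ => //; exact: FA.
have xyn y : F y -> delta * t < enorm (x - y) < t * L.
  move=> /xy Qxy; have := QL _ Qxy; have := Qdelta _ Qxy.
  rewrite enormZ gtr0_norm ?invr_gt0// => h1 h2; apply/andP; split.
    by move: h1; rewrite ltr_pdivlMl// mulrC.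
  by move: h2; rewrite ltr_pdivrMl.
have OmE y : F y -> Om (t^-1 *: (x - y)) = Om (x - y).
  move=> Fy; rewrite homogeneousZ ?invr_gt0// -enorm_gt0.
  by case/andP: (xyn _ Fy) => + _; apply: lt_trans; exact: mulr_gt0.
(* By homogeneity, bad points [y] come from bad points [z] of [Q] through the reflection
   [x - t z]. *)
have subE (P : R -> Prop) : F `&` [set y | P (sg * Om (x - y))] `<=`
    [set x - t *: z | z in Q `&` [set w | P (sg * Om w)]].
  move=> y [Fy /= Py]; exists (t^-1 *: (x - y)).
    by split; [exact: xy|rewrite /= OmE].
  by rewrite -xyE opprB addrC subrK.
have bad (P : R -> Prop) (u : R) :
    (mu (Q `&` [set w | P (sg * Om w)%R]) <= u%:E)%E ->
    (mu (F `&` [set y | P (sg * Om (x - y))%R]) <= ((2 * t) ^+ n.+1 * u)%:E)%E.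
  move=> Pu; apply: le_trans (le_lebesgue_outer (subE P)) _.
  apply: le_trans (lebesgue_outer_reflection_le _ _ _ t0) _.
  by rewrite EFinM; apply: lee_wpmul2l => //; rewrite lee_fin exprn_ge0// mulr_ge0// ltW.
(* Chosen so that the distances, between [delta t] and [t L], lie strictly between [e1] and its
   inverse. *)
pose e1 := Num.min (delta * t) (t * L)^-1.
have tL0 : 0 < t * L by exact: mulr_gt0.
have e10 : 0 < e1 by rewrite lt_min mulr_gt0//= invr_gt0.
have Fe1 : F `<=` annulus x e1.
  move=> y /xyn/andP[h1 h2]; apply/andP; split; first by rewrite gt_min h1.
  apply: lt_le_trans h2 _.
  by rewrite -[leLHS]invrK lef_pV2 ?posrE ?invr_gt0// ge_min lexx orbT.
have Fv : ((v / 2)%:E <= leb F)%E.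
  by move: AF; rewrite [leb _]vE -lee_pdivrMl// -EFinM mulrC.
have Fneg : mu (F `&` [set y | sg * Om (x - y) < 0]) = 0%E.
  apply/eqP; rewrite eq_le lebesgue_outer_ge0 andbT.
  by have := bad (fun s => s < 0) 0; rewrite mulr0; apply; rewrite Qneg.
have Fbad : (mu (F `&` [set y | (sg * Om (x - y) < e)%R]) <= (v / 4)%:E)%E.
  apply: le_trans (bad (fun s => s < e) ((4 ^+ n.+2)^-1 * q) _) _.
    by rewrite EFinM -qE.
  rewrite lee_fin; apply: le_trans (_ : (t / 2) ^+ n.+1 * q / 4 <= _); last first.
    by rewrite ler_pM2r.
  have -> : 4 = 2 * 2 :> R by rewrite -natrM.
  rewrite !exprS !exprMn exprVn le_eqVlt; apply/orP; left; apply/eqP.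
  by field; rewrite ?expf_neq0.
have FM y : F y -> enorm (x - y) <= t * L by move/xyn/andP=> [_ /ltW].
have := commutator_lower_bound _ _ _ _ _ _ _ _ _ _ _ _ _ mF e10 Fe1 i1 i2 sg1 tau1 c0 d0
  (ltW e0) tL0 Fd FM Fneg Fv Fbad.
apply: le_trans; rewrite -[leRHS]mulrA ler_wpM2l ?mulr_ge0//.
have Ln : L ^+ n.+1 != 0 by rewrite expf_neq0// gt_eqF.
have -> : e * q / (4 * (2 * L) ^+ n.+1) =
    e / (t * L) ^+ n.+1 * ((t / 2) ^+ n.+1 * q / 4).
  rewrite !exprMn exprVn; field.
  by rewrite Ln !expf_neq0 ?gt_eqF.
apply: ler_wpM2l; first by rewrite divr_ge0 ?exprn_ge0// ltW.
lra.
Qed.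

End test_set.

(** * Indicators and averages in a ball Banach function space *)

Section ball_banach.
Context {R : realType} {n : nat} {N : (Rn R n -> R) -> \bar R}.
Implicit Types (A B : set (Rn R n)) (f g : Rn R n -> R).

Lemma bbfs_le_indic (bN : ball_banach_function_space N) A B :
  measurable A -> measurable B -> A `<=` B -> (N (\1_A) <= N (\1_B))%E.
Proof.
move=> mA mB AB; apply: (bbfs_lattice bN) => //; try exact: measurable_indic.
apply: aeW => x; rewrite !indicE !ger0_norm// ler_nat.
by have [/set_mem/AB/mem_set->|] := boolP (x \in A).
Qed.

Lemma bbfs_indic_fin (bN : ball_banach_function_space N) A x r :
  measurable A -> 0 < r -> A `<=` eball x r -> (N (\1_A) < +oo)%E.
Proof.
move=> mA r0 Ax; apply: le_lt_trans (bbfs_ball bN x r0).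
apply: bbfs_le_indic => //; exact: measurable_eball.
Qed.

Lemma bbfs_indic_gt0 (bN : ball_banach_function_space N) A :
  measurable A -> (0 < leb A)%E -> (0 < N (\1_A))%E.
Proof.
move=> mA A0; rewrite lt_def (bbfs_ge0 bN) andbT; apply: contraTneq A0.
move/(bbfs_eq0 bN) => [Z [mZ Z0 AZ]]; rewrite -leNgt -Z0.
apply: le_measure; rewrite ?inE// => x Ax; apply: AZ => /= /eqP.
by rewrite indicE mem_set// oner_eq0.
Qed.

Lemma average_ge0 B f : (0 <= average B f)%E.
Proof.
by rewrite mule_ge0 ?integral_ge0// lee_fin invr_ge0 fine_ge0.
Qed.

Lemma average_fin (bN : ball_banach_function_space N) x r f :
  0 < r -> (N f < +oo)%E -> average (eball x r) f \is a fin_num.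
Proof.
move=> r0 Nf; rewrite ge0_fin_numE ?average_ge0//.
have [C C0 /(_ f Nf) fC] := bbfs_integral bN x r0.
apply: lte_mul_pinfty => //; first by rewrite lee_fin invr_ge0 fine_ge0.
apply: le_lt_trans fC _; apply: lte_mul_pinfty => //; exact: ltW.
Qed.

(** Every point of [A] lies in the ball, so the average times the indicator of [A] is below the
    maximal function of [g]; then the lattice property and the maximal bound apply. *)
Lemma maximal_indic_average (bN : ball_banach_function_space N) (C : R) A x r g :
  (forall f, (N f < +oo)%E -> {ae leb, forall x, maximal f x \is a fin_num} /\
    (N (fun x => fine (maximal f x)) <= C%:E * N f)%E) ->
  measurable A -> 0 < r -> A `<=` eball x r -> (N g < +oo)%E ->
  (average (eball x r) g * N (\1_A) <= C%:E * N g)%E.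
Proof.
move=> NC mA r0 Ax Ng; have [Mfin MC] := NC _ Ng.
apply: le_trans MC.
have [al alE] : exists al, average (eball x r) g = al%:E.
  by exists (fine (average (eball x r) g)); rewrite fineK// average_fin.
have al0 : 0 <= al by have := average_ge0 (eball x r) g; rewrite alE.
have NA := bbfs_indic_fin bN _ _ _ mA r0 Ax.
rewrite alE -{1}(ger0_norm al0) -(bbfsZ bN)//.
(* Finite norm is what gives measurability of the maximal function for the lattice property; if the
   norm is infinite there is nothing to prove. *)
have [Moo|] := ltP (N (fun x => fine (maximal g x))) +oo%E; last first.
  by rewrite leye_eq => /eqP ->; exact: leey.
apply: (bbfs_lattice bN).
- exact: (bbfs_measurable bN).
- by apply: (measurable_funM (f := cst al)) => //; exact: measurable_indic.
apply: filterS Mfin => y My; rewrite indicE.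
have [/set_mem Ay|] := boolP (y \in A); last by rewrite mulr0 normr0.
rewrite mulr1 ger0_norm//; apply: le_trans (ler_norm _).
rewrite -lee_fin fineK// -alE; apply: ereal_sup_ubound.
by exists (x, r) => //; split => //; exact: Ax.
Qed.

End ball_banach.

(** * From commutator bounds to mean oscillation *)

(** In the constant, [rho ^ (n + 1)] compares the measures of the two balls, one factor 2 comes from
    the two parts of [A], and another from replacing the median by the mean. *)
Lemma mean_oscillation_commutator (R : realType) (n : nat)
    (N : (Rn R n -> R) -> \bar R) (Omega b : Rn R n -> R) (C kappa rho r : R)
    (x0 : Rn R n) (A : set (Rn R n)) :
  ball_banach_function_space N -> 0 <= C ->
  (forall f, (N f < +oo)%E -> {ae leb, forall x, maximal f x \is a fin_num} /\
    (N (fun x => fine (maximal f x)) <= C%:E * N f)%E) ->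
  0 < kappa -> 1 <= rho -> 0 < r ->
  measurable A -> A `<=` eball x0 (rho * r) -> (0 < leb A)%E ->
  commutator_test_set Omega kappa A (eball x0 r) ->
  locally_integrable_Rn b -> commutator_bounded N b Omega ->
  (average (eball x0 r) (fun y => b y - mean (eball x0 r) b)%R <=
    (4 * rho ^+ n.+1 * C / kappa)%:E * commutator_opnorm N b Omega)%E.
Proof.
move=> bN C0 NC kappa0 rho1 r0 mA AB A0 testA bloc [bT Poo].
have rho0 : 0 < rho by exact: lt_le_trans rho1.
have rr0 : 0 < rho * r by exact: mulr_gt0.
set B := eball x0 r; set B2 := eball x0 (rho * r) in AB.
have mB : measurable B by exact: measurable_eball.
have mB2 : measurable B2 by exact: measurable_eball.
have BB2 : B `<=` B2.
  by move=> y; rewrite /B /B2 /eball/= => /lt_le_trans; apply; rewrite ler_peMl// ltW.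
have [l2 l2E] : exists l, leb B2 = l%:E.
  by exists (fine (leb B2)); rewrite fineK// ge0_fin_numE// leb_eball_fin.
have [l lE] : exists l, leb B = l%:E.
  by exists (fine (leb B)); rewrite fineK// ge0_fin_numE// leb_eball_fin.
have A2 : (leb A <= leb B2)%E by apply: le_measure; rewrite ?inE.
have l20 : 0 < l2 by rewrite -lte_fin -l2E; exact: lt_le_trans A2.
have l2l : l2 <= rho ^+ n.+1 * l.
  by rewrite -lee_fin EFinM -l2E -lE; exact: leb_eball_scale_le.
have l0 : 0 < l.
  by have := lt_le_trans l20 l2l; rewrite pmulr_rgt0// exprn_gt0.
have Aoo : (leb A < +oo)%E by apply: le_lt_trans A2 _; rewrite l2E ltry.
have mb : measurable_fun setT b by exact: bloc.1.
have [m [F1 F2]] := measure_median _ _ _ leb _ _ mA A0 Aoo mb.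
have NA0 := bbfs_indic_gt0 bN _ mA A0.
have NAoo := bbfs_indic_fin bN _ _ _ mA rr0 AB.
have [nu nuE] : exists nu, N \1_A = nu%:E.
  by exists (fine (N \1_A)); rewrite fineK// ge0_fin_numE// ltW.
have nu0 : 0 < nu by move: NA0; rewrite nuE.
(* Division by the norm [nu] of the indicator of [A] puts these functions in the unit ball, over
   which the operator norm is a supremum. *)
pose f (F : set (Rn R n)) y := nu^-1 * (\1_F y : R).
pose g F := commutator b Omega (f F).
have Nf F : measurable F -> F `<=` A -> (N (f F) <= 1)%E.
  move=> mF FA; have NFA := bbfs_le_indic bN _ _ mF mA FA.
  rewrite (bbfsZ bN); last exact: le_lt_trans NFA NAoo.
  rewrite ger0_norm ?invr_ge0 ?(ltW nu0)//.
  by rewrite lee_pdivrMl// mule1 -nuE.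
have Nfoo F : measurable F -> F `<=` A -> (N (f F) < +oo)%E.
  by move=> mF FA; apply: le_lt_trans (Nf _ mF FA) (ltry _).
have NgP F : measurable F -> F `<=` A -> (N (g F) <= commutator_opnorm N b Omega)%E.
  by move=> mF FA; apply: ereal_sup_ubound; exists (f F) => //; exact: Nf.
have P0 : (0 <= commutator_opnorm N b Omega)%E.
  exact: le_trans (bbfs_ge0 bN _) (NgP _ mA (@subset_refl _ A)).
have [P PE] : exists P, commutator_opnorm N b Omega = P%:E.
  by exists (fine (commutator_opnorm N b Omega)); rewrite fineK// ge0_fin_numE.
rewrite PE in P0 NgP *; rewrite lee_fin in P0.
have mg F : measurable F -> F `<=` A -> measurable_fun setT (g F).
  by move=> mF FA; apply: (bbfs_measurable bN); exact: (bT _ (Nfoo _ mF FA)).2.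
have intg F : measurable F -> F `<=` A ->
    (\int[leb]_(x in B) `|g F x|%:E <= (rho ^+ n.+1 * l * (C * P / nu))%:E)%E.
  move=> mF FA.
  have Ngoo : (N (g F) < +oo)%E by exact: (bT _ (Nfoo _ mF FA)).2.
  have := maximal_indic_average bN _ _ _ _ _ NC mA rr0 AB Ngoo.
  have [al alE] : exists al, average B2 (g F) = al%:E.
    by exists (fine (average B2 (g F))); rewrite fineK// (average_fin bN).
  rewrite -/B2 alE nuE => h.
  have {}h : al * nu <= C * P.
    rewrite -lee_fin EFinM; apply: le_trans h _; rewrite EFinM.
    by apply: lee_wpmul2l; [rewrite lee_fin|exact: NgP].
  have al0 : 0 <= al by have := average_ge0 B2 (g F); rewrite alE.
  (* The integral is enlarged to [B2], which contains [A], because the average controlled through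
     the maximal function is the one over [B2]. *)
  apply: (@le_trans _ _ (\int[leb]_(x in B2) `|g F x|%:E)%E).
    apply: (ge0_subset_integral leb mB mB2) BB2; last by move=> x _; rewrite lee_fin.
    by apply: measurable_fun_normr_EFin; exact: mg.
  have -> : (\int[leb]_(x in B2) `|g F x|%:E = l2%:E * average B2 (g F))%E.
    by rewrite /average l2E/= muleA -EFinM divff ?gt_eqF// mul1e.
  rewrite alE -EFinM lee_fin; apply: ler_pM => //; first exact: ltW.
  by rewrite ler_pdivlMr.
pose F_ (i : bool) := A `&` if i then [set x | b x <= m] else [set x | m <= b x].
have mbA : measurable_fun A b by exact: measurable_funTS.
have mF_ i : measurable (F_ i).
  by case: i; [exact: measurable_sublevel|exact: measurable_superlevel].
have FA_ i : F_ i `<=` A by move=> x [].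
have exF i : commutator_exists b Omega (f (F_ i)).
  exact: (bT _ (Nfoo _ (mF_ i) (FA_ i))).1.
have nuV0 : 0 <= nu^-1 by rewrite invr_ge0 ltW.
have osc : {ae leb, forall x, B x ->
    `|b x - m| <= (nu / kappa) * (`|g (F_ true) x| + `|g (F_ false) x|)}.
  apply: filterS2 (exF true) (exF false) => x [i1 i2] [j1 j2] Bx.
  suff : `|b x - m| * nu^-1 * kappa <= `|g (F_ true) x| + `|g (F_ false) x|.
    rewrite -ler_pdivrMl ?divr_gt0// invfM invrK; apply: le_trans.
    by rewrite le_eqVlt; apply/orP; left; apply/eqP; ring.
  (* Above the median [b x] is compared with the lower part of [A], below it with the upper part, so
     that [b x - b y] keeps a constant sign. *)
  have [mx|xm] := leP m (b x).
    rewrite ger0_norm ?subr_ge0//.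
    apply: le_trans (_ : `|g (F_ true) x| <= _); last by rewrite lerDl.
    apply: (testA _ _ _ _ _ _ (mF_ true) (FA_ true) F1 Bx (normr1 R) nuV0 _ _ i1 i2).
      by rewrite subr_ge0.
    by move=> y [_ /= ym]; rewrite mul1r lerD2l lerN2.
  rewrite ltr0_norm ?subr_lt0//.
  apply: le_trans (_ : `|g (F_ false) x| <= _); last by rewrite lerDr.
  apply: (testA _ _ _ _ _ _ (mF_ false) (FA_ false) F2 Bx (normrN1 R) nuV0 _ _ j1 j2).
    by rewrite oppr_ge0 subr_le0 ltW.
  by move=> y [_ /= ym]; rewrite mulN1r lerN2 lerD2l lerN2.
have bi : leb.-integrable B (EFin \o b) by exact: locally_integrable_eball.
have oscB : (\int[leb]_(x in B) `|b x - m|%:E <=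
    (2 * rho ^+ n.+1 * l * C * P / kappa)%:E)%E.
  have -> : 2 * rho ^+ n.+1 * l * C * P / kappa =
      nu / kappa * (2 * (rho ^+ n.+1 * l * (C * P / nu))).
    by field; rewrite !gt_eqF.
  have mbm : measurable_fun setT (fun x => b x - m).
    exact: (measurable_funB mb (measurable_cst m)).
  have nk0 : 0 <= nu / kappa by rewrite divr_ge0 ?ltW.
  exact: (ae_le_normr_integral _ _ _ _ _ _ _ _ _ _ mB mbm (mg _ (mF_ true) (FA_ true))
    (mg _ (mF_ false) (FA_ false)) nk0 osc
    (intg _ (mF_ true) (FA_ true)) (intg _ (mF_ false) (FA_ false))).
have B0 : (0 < leb B)%E by rewrite lE.
have Boo : (leb B < +oo)%E by rewrite lE ltry.
have moB := mean_oscillation_le _ _ _ leb _ _ m mB B0 Boo bi.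
rewrite /average /mean.
apply: (@le_trans _ _ (((fine (leb B))^-1)%:E *
    (2%:E * (2 * rho ^+ n.+1 * l * C * P / kappa)%:E))%E).
  apply: lee_wpmul2l; first by rewrite lE lee_fin invr_ge0 ltW.
  by apply: le_trans moB _; apply: lee_wpmul2l.
rewrite lE /= -!EFinM lee_fin le_eqVlt; apply/orP; left; apply/eqP.
by field; rewrite !gt_eqF.
Qed.

(** * Choice of the sign and of a constant independent of [b] *)

Theorem theorem2p22 (R : realType) (n : nat)
    (N : (Rn R n -> R) -> \bar R) (Omega : Rn R n -> R)
    (Lambda : set (Rn R n)) :
  ball_banach_function_space N ->
  maximal_bounded N ->
  homogeneous_degree0 Omega ->
  Linfty_sphere Omega ->
  (\int[@sphere_measure R n]_(x in sphere) (Omega x)%:E = 0)%E ->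
  open_in_sphere Lambda ->
  keeps_sign Omega Lambda ->
  exists2 C : R, 0 < C &
    forall b : Rn R n -> R,
      locally_integrable_Rn b ->
      commutator_bounded N b Omega ->
      bmo b /\ (bmo_norm b <= C%:E * commutator_opnorm N b Omega)%E.
Proof.
move=> bN [C NC] hOm [mOm _] _ [U oU ->] [sign nz].
have [sg [sg1 [e [delta [p box_p]]]]] : exists sg : R, `|sg| = 1 /\
    exists (e delta : R) (p : Rn R n * Rn R n),
      sign_box (fun w => sg * Omega w) (4 ^+ n.+2)^-1 e delta p.
  have key (sg : R) : `|sg| = 1 ->
      {ae @sphere_measure R n, forall x, (U `&` sphere) x -> 0 <= sg * Omega x} ->
      exists (e delta : R) (p : Rn R n * Rn R n),
        sign_box (fun w => sg * Omega w) (4 ^+ n.+2)^-1 e delta p.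
    move=> sg1 sgn; apply: (exists_sign_box _ U _ _ _ oU sgn).
    - by move=> t x t0 sx; rewrite hOm.
    - exact: (measurable_funM (measurable_cst sg) mOm).
    - move=> h; apply: nz; apply: negligibleS h => x /=; apply: contra_not.
      move=> /[swap] Ux /(_ Ux) /eqP.
      by rewrite mulf_eq0 -normr_eq0 sg1 oner_eq0 => /eqP.
    - by rewrite invr_gt0 exprn_gt0.
    - by rewrite invf_lt1 ?exprn_gt0// exprn_egt1// ltr1n.
  case: sign => sgn; [exists 1|exists (-1)]; split; rewrite ?normrN1 ?normr1//.
  - by apply: key; [rewrite normr1|apply: negligibleS sgn => x /=;
      apply: contra_not => h /h; rewrite mul1r].
  - apply: key; first by rewrite normrN1.
    apply: negligibleS sgn => x /=; apply: contra_not => h /h.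
    by rewrite mulN1r oppr_ge0.
have [kappa [rho [kappa0 rho0 test]]] :=
  exists_commutator_test_set _ _ _ _ _ hOm sg1 box_p.
(* At least 1, so that the enlarged ball contains the original ball as well as the test set. *)
pose rho' := Num.max 1 rho.
have rho'1 : 1 <= rho' by rewrite le_max lexx.
(* [C] comes with no sign; [|C| + 1] is also a bound for the maximal operator and makes [K]
   positive. *)
pose K := 4 * rho' ^+ n.+1 * (`|C| + 1) / kappa.
have K0 : 0 < K.
  rewrite divr_gt0// mulr_gt0// ?mulr_gt0 ?exprn_gt0 ?ltr_wpDl//.
  exact: lt_le_trans rho'1.
exists K => // b bloc bT.
have bK : (bmo_norm b <= K%:E * commutator_opnorm N b Omega)%E.
  apply: ge_ereal_sup => _ [[x0 r] /= r0 <-].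
  have [A [mA AB A0 testA]] := test x0 r r0.
  have C0 : 0 <= `|C| + 1 by rewrite addr_ge0.
  apply: (mean_oscillation_commutator _ _ _ _ _ (`|C| + 1) kappa rho' r x0 A bN C0
    _ kappa0 rho'1 r0 mA _ A0 testA bloc bT).
  - move=> f Nf; have [? CN] := NC f Nf; split => //; apply: le_trans CN _.
    apply: lee_wpmul2r; first exact: bbfs_ge0.
    by rewrite lee_fin (le_trans (ler_norm _))// lerDl.
  - apply: subset_trans AB _ => y; rewrite /eball/= => /lt_le_trans; apply.
    by rewrite ler_pM2r// le_max lexx orbT.
split => //; split => //; apply: le_lt_trans bK _.
have Poo := bT.2.
case: (commutator_opnorm N b Omega) Poo => [P _|//|_].
  by rewrite -EFinM ltry.
by rewrite gt0_muleNy ?lte_fin.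
Qed.
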